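(* Let $d$ be even, let $\mathcal{G}$ be a class of generators of the hyperbolic quadric $Q^+(2d-1,q)$, let $\mathcal{L}\subseteq\mathcal{G}$, put $x=|\mathcal{L}|/\prod_{k=1}^{d-2}(q^k+1)$, and let $i$ be an integer with $1\le i\le d/2$. Then $\mathcal{L}$ is a Cameron-Liebler set of generators in $\mathcal{G}$ if and only if for every generator $\pi\in\mathcal{G}$ the number of elements of $\mathcal{L}$ meeting $\pi$ in a $(d-2i-1)$-space equals $$\left((x-1)\begin{bmatrix} d-1\\ 2i-1\end{bmatrix}_q+q^{2i-1}\begin{bmatrix} d-1\\ 2i\end{bmatrix}_q\right)q^{(2i-1)(i-1)}\ \text{ if }\pi\in\mathcal{L},\qquad x\begin{bmatrix} d-1\\ 2i-1\end{bmatrix}_q q^{(2i-1)(i-1)}\ \text{ if }\pi\notin\mathcal{L}.$$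
   Context: The generators of the hyperbolic quadric $Q^+(2d-1,q)$ are its totally singular subspaces of projective dimension $d-1$; they split into two classes such that two generators are in the same class iff the projective dimension of their intersection is $\equiv d \pmod 2$. A $(-1)$-space means the empty subspace. $\begin{bmatrix} a\\ b\end{bmatrix}_q=\prod_{k=1}^b\frac{q^{a-b+k}-1}{q^k-1}$. A set $\mathcal{L}$ of generators of one class $\mathcal{G}$, with characteristic vector $\chi\in\mathbb{R}^{\mathcal{G}}$, is a Cameron-Liebler set of generators in $\mathcal{G}$ if $\chi\in\mathrm{im}(A_{\mathcal{G}}^T)$, where $A_{\mathcal{G}}$ is the real incidence matrix of points of $Q^+(2d-1,q)$ versus generators in $\mathcal{G}$; its parameter is $x=|\mathcal{L}|/\prod_{k=1}^{d-2}(q^k+1)$ (so the set of generators of $\mathcal{G}$ through a point has parameter $1$).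
   Formalization: Two generators are in the same class iff the projective dimension of their intersection is ≡ d-1 (mod 2); the stated ''≡ d (mod 2)'' fails already for a generator and itself, whose intersection has projective dimension d-1. *)

(* Defs.v *)
From HB Require Import structures.
From mathcomp Require Import all_boot all_order all_algebra.
From mathcomp Require Import reals.

Set Implicit Arguments.
Unset Strict Implicit.
Unset Printing Implicit Defensive.

Import Order.TTheory GRing.Theory Num.Theory.
Local Open Scope ring_scope.

(* vector.v gives {vspace vT} a choiceType structure only; its subType structure
   over matrices is visible only through VectorInternalTheory. *)
Section VspaceFinite.
Import VectorInternalTheory.
Variables (F : finFieldType) (vT : vectType F).

HB.instance Definition _ := [Countable of {vspace vT} by <:].
HB.instance Definition _ := [Finite of {vspace vT} by <:].

End VspaceFinite.

(* Subspaces of PG(2d-1,q) are vector subspaces of F^(2d), where q = #|F|;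
   the projective dimension is \dim - 1, so the zero vector space is the
   empty, i.e. (-1)-dimensional, projective subspace. *)
Section HyperbolicQuadric.
Variables (F : finFieldType) (d : nat).

(* Q^+(2d-1,q) is the zero locus of the standard hyperbolic form
   X_0 X_d + X_1 X_(d+1) + ... + X_(d-1) X_(2d-1). *)
Definition hyp_form (v : 'rV[F]_(d + d)) : F :=
  \sum_(j < d) v 0 (lshift d j) * v 0 (rshift d j).

Definition totally_singular (U : {vspace 'rV[F]_(d + d)}) : bool :=
  [forall v : 'rV[F]_(d + d), (v \in U) ==> (hyp_form v == 0)].

Definition points : {set {vspace 'rV[F]_(d + d)}} :=
  [set U | totally_singular U & \dim U == 1%N].

Definition generators : {set {vspace 'rV[F]_(d + d)}} :=
  [set U | totally_singular U & \dim U == d].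

(* The dimension here is the vector space dimension, so that a generator is
   in the same class as itself: \dim (U :&: U) = d. *)
Definition same_class (U W : {vspace 'rV[F]_(d + d)}) : bool :=
  (\dim (U :&: W) == d %[mod 2])%N.

Definition generator_classes : {set {set {vspace 'rV[F]_(d + d)}}} :=
  equivalence_partition same_class generators.

End HyperbolicQuadric.

Section CameronLiebler.
Variables (R : realType) (F : finFieldType) (d : nat).
Implicit Types G L : {set {vspace 'rV[F]_(d + d)}}.

Definition incidence_mx G : 'M[R]_(#|points F d|, #|G|) :=
  \matrix_(a, b) ((enum_val a <= enum_val b)%VS)%:R.

Definition char_vec G L : 'cV[R]_#|G| :=
  \col_b (enum_val b \in L)%:R.

Definition cameron_liebler G L : Prop :=
  L \subset G /\
  exists w : 'cV[R]_#|points F d|, char_vec G L = (incidence_mx G)^T *m w.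

Definition parameter L : R :=
  #|L|%:R / \prod_(1 <= k < d.-1) (#|F|%:R ^+ k + 1).

End CameronLiebler.

(* The exponent a - b + k is written a + k - b so that truncated subtraction
   is harmless: if a < b, the factor k = b - a is 0, as it should be. *)
Definition gauss_binom (R : realType) (q a b : nat) : R :=
  \prod_(1 <= k < b.+1) ((q%:R ^+ (a + k - b) - 1) / (q%:R ^+ k - 1)).

(* Main.v *)
(* Let N be the incidence matrix of points versus G, J the all-one matrix, and
   A_i the adjacency matrix of the graph on G joining generators whose
   intersection has codimension 2i.  The number of A_i-neighbours of a generator
   pi that pass through a point p is k0 if p is on pi and k1 otherwise, so
   A_i N^T = (k0 - k1) N^T + k1 J; this gives the direct implication.
   Conversely, project chi orthogonally onto im N^T: the remainder v satisfies
   N v = 0 and A_i v = (k0 - k1) v, and must be shown to vanish.  Take a totally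
   singular subspace S of minimal dimension j such that the sum c of v over the
   generators of G through S is not 0.  Moebius inversion below S gives the sum
   of v over the generators meeting S in a given subspace, so summing A_i v over
   the generators through S yields (k0 - k1) c = P_j c, with P_j an explicit
   alternating sum of products of Gaussian binomials, and P_1 = k0 - k1.  For
   2 <= j <= d/2 this is impossible: if i >= 2, P_j and P_1 have different q-adic
   valuations, and if i = 1, P_j is, up to an affine map not depending on j, the
   square of q^j + q^(d-j).  Hence the sums vanish up to dimension d/2; since
   dim (pi :&: rho) takes only d/2 values below d on G, interpolation in
   q^dim (pi :&: rho) then isolates v at pi. *)

From HB Require Import structures.
Require Import Defs.
From mathcomp Require Import all_boot all_order all_algebra finfield.
From mathcomp Require Import reals zify ring.

Set Implicit Arguments.
Unset Strict Implicit.
Unset Printing Implicit Defensive.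

Import Order.TTheory GRing.Theory Num.Theory.
Local Open Scope ring_scope.

(** * Gaussian binomials and counts of subspaces *)

(* If e' > n' the exponent n' - e' is truncated, but then [qbin q n' e' = 0]. *)
Fixpoint qbin (q n e : nat) : nat :=
  match n, e with
  | _, 0 => 1
  | 0, _.+1 => 0
  | n'.+1, e'.+1 => qbin q n' e'.+1 + q ^ (n' - e') * qbin q n' e'
  end.

Lemma qbinn0 q n : qbin q n 0 = 1%N. Proof. by case: n. Qed.

Lemma qbinS q n e :
  qbin q n.+1 e.+1 = (qbin q n e.+1 + q ^ (n - e) * qbin q n e)%N.
Proof. by []. Qed.
Arguments qbin : simpl never.

Lemma qbin_small q n e : (n < e)%N -> qbin q n e = 0%N.
Proof.
elim: n e => [|n IHn] [|e] // ltne.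
by rewrite qbinS !IHn // ?muln0 //; lia.
Qed.

Lemma qbinnn q n : qbin q n n = 1%N.
Proof.
by elim: n => [|n IHn] //; rewrite qbinS IHn qbin_small // subnn expn0.
Qed.

(** In the recursion the second summand vanishes modulo [q] unless its power of [q] is 1.
    Consequently the only powers of [q] dividing an eigenvalue term are those written explicitly. *)
Lemma qbin_modq q n e : (1 < q)%N -> (e <= n)%N -> qbin q n e = 1 %[mod q].
Proof.
move=> q_gt1; elim: n e => [|n IHn] [|e] // len; rewrite ?qbinn0 // qbinS.
have [eqne|neqne] := eqVneq e n.
  by rewrite eqne qbinnn qbin_small // subnn expn0.
have ltne : (e < n)%N by lia.
rewrite -(subnSK ltne) expnS -mulnA addnC mulnC modnMDl.
exact: IHn.
Qed.

(** Both sides obey the same Pascal rule once the common denominator is cleared; for [n < e] the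
    product contains the zero factor [k = e - n]. *)
Lemma gauss_binomE (R : realType) q n e :
  (1 < q)%N -> gauss_binom R q n e = (qbin q n e)%:R.
Proof.
move=> q_gt1.
have qX k : (0 < k)%N -> q%:R ^+ k - 1 != 0 :> R.
  move=> k_gt0; rewrite subr_eq0 -natrX pnatr_eq1 neq_ltn.
  by rewrite -{2}(exp1n k) ltn_exp2r // q_gt1 orbT.
have gb0 m : gauss_binom R q m 0 = 1 by rewrite /gauss_binom big_geq.
have gb_small m f : (m < f)%N -> gauss_binom R q m f = 0.
  move=> ltmf; rewrite /gauss_binom (big_cat_nat (n := (f - m)%N)) /=; try lia.
  rewrite [X in _ * X]big_ltn; last lia.
  by rewrite (_ : m + (f - m) - f = 0)%N ?expr0 ?subrr ?mul0r ?mulr0 //; lia.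
have qe m f : gauss_binom R q m f * \prod_(1 <= k < f.+1) (q%:R ^+ k - 1)
     = \prod_(1 <= k < f.+1) (q%:R ^+ (m + k - f) - 1).
  rewrite /gauss_binom -big_split /= !big_nat; apply: eq_bigr => k /andP[k1 _].
  by rewrite divfK // qX.
elim: n e => [|n IHn] [|e]; rewrite ?gb0 ?qbinn0 //; first by rewrite gb_small.
rewrite qbinS natrD natrM -!IHn natrX.
have [ltne|leen] := ltnP n e.
  by rewrite !gb_small ?mulr0 ?addr0 //; lia.
have D0 f : \prod_(1 <= k < f.+1) (q%:R ^+ k - 1) != 0 :> R.
  by rewrite prodf_seq_neq0; apply/allP => k; rewrite mem_index_iota => /andP[k1 _]; rewrite qX.
apply: (mulIf (D0 e.+1)).
rewrite mulrDl !qe [X in _ = _ + _ * X]big_nat_recr //= -mulrA (mulrA (gauss_binom _ _ _ _)) qe.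
rewrite [LHS]big_nat_recr //= [X in _ = X + _]big_nat_recl //=.
rewrite (_ : n + 1 - e.+1 = n - e)%N; last lia.
have e1 : \prod_(1 <= k < e.+1) (q%:R ^+ (n.+1 + k - e.+1) - 1) =
    \prod_(1 <= k < e.+1) (q%:R ^+ (n + k - e) - 1) :> R.
  by apply: eq_bigr => k _; rewrite addSn subSS.
have e2 : \prod_(1 <= k < e.+1) (q%:R ^+ (n + k.+1 - e.+1) - 1) =
    \prod_(1 <= k < e.+1) (q%:R ^+ (n + k - e) - 1) :> R.
  by apply: eq_bigr => k _; rewrite addnS subSS.
rewrite e1 e2 (_ : n.+1 + e.+1 - e.+1 = (n - e) + e.+1)%N ?exprD; last lia.
ring.
Qed.

(** Induction on [n]: the summand [q ^ (n - e) * qbin q n e] of the Pascal rule supplies the new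
    factor [q ^ n * x]. The values at [x = -1] give Moebius cancellation, those at [x = 1] the
    number of generators through a point. *)
Lemma q_binomial_theorem (R : comNzRingType) q n (x : R) :
  \sum_(e < n.+1) (qbin q n e * q ^ 'C(e, 2))%:R * x ^+ e
    = \prod_(k < n) (1 + q%:R ^+ k * x).
Proof.
elim: n => [|n IHn]; first by rewrite big_ord_recl !big_ord0 /= bin0n !mul1n !expr0 mulr1 addr0.
rewrite [in RHS]big_ord_recr /= -IHn mulrDr mulr1 big_ord_recl.
under eq_bigr => e _ do rewrite lift0 qbinS mulnDl natrD mulrDl.
rewrite big_split /= addrA; congr (_ + _).
  rewrite [in LHS]big_ord_recr /= (qbin_small _ (ltnSn n)) mul0n mul0r addr0.
  by rewrite big_ord_recl !qbinn0.
rewrite mulr_suml; apply: eq_bigr => e _.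
have e_le : (e <= n)%N by rewrite -ltnS ltn_ord.
rewrite binS bin1 exprS -natrX -[in (q ^ n)%N](subnK e_le) !expnD !natrM; ring.
Qed.

Section SubspaceCounts.
Variables (F : finFieldType) (vT : vectType F).
Implicit Types (S T U V M : {vspace vT}) (u v : vT).
Local Notation q := #|F|.

Lemma dim_add_line U v : v \notin U -> \dim (U + <[v]>) = (\dim U).+1.
Proof.
move=> vU; have v0 : v != 0 by apply: contraNneq vU => ->; rewrite mem0v.
rewrite -[LHS](addn0 _) -addn1 -[1%N]/(nat_of_bool true) -v0 -dim_vline -dimv_sum_cap.
congr addn; apply/esym/eqP; rewrite dimv_eq0 -subv0; apply/subvP => w.
rewrite memv_cap memv0 => /andP[wU /vlineP[k ew]].
apply: contraNT vU => w0; have k0 : k != 0 by apply: contraNneq w0 => k0; rewrite ew k0 scale0r.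
by rewrite -(scalerK k0 v) -ew memvZ.
Qed.

Lemma subv_add_line U V v : (U + <[v]> <= V)%VS = (U <= V)%VS && (v \in V).
Proof. by rewrite subv_add -memvE. Qed.

Lemma hyperplane_add_line M V v :
  (M <= V)%VS -> v \in V -> v \notin M -> (\dim M).+1 = \dim V -> (M + <[v]>)%VS = V.
Proof.
move=> MV vV vM dM; apply/eqP; rewrite eqEdim subv_add_line MV vV /=.
by rewrite dim_add_line // dM.
Qed.

Lemma exists_notin U V : (\dim U < \dim V)%N -> exists2 v, v \in V & v \notin U.
Proof.
move=> ltUV; apply/subvPn; apply: contraL ltUV => /dimvS; by rewrite -leqNgt.
Qed.

Definition hyperplanes_avoiding S V v : {set {vspace vT}} :=
  [set M | [&& (S <= M)%VS, (M <= V)%VS, v \notin M & (\dim M).+1 == \dim V]].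

(* If u is in V but not in S + <[v]>, such a hyperplane contains u + a *: v for
   exactly one scalar a. *)
Lemma card_hyperplanes_avoiding n S V v :
  (S <= V)%VS -> v \in V -> v \notin S -> \dim V = (\dim S + n).+1 ->
  #|hyperplanes_avoiding S V v| = (q ^ n)%N.
Proof.
elim: n S => [|n IHn] S SV vV vS dV.
  rewrite (_ : hyperplanes_avoiding _ _ _ = [set S]) ?cards1 //.
  apply/setP => M; rewrite !inE dV addn0 eqSS.
  apply/and4P/eqP => [[SM _ _ /eqP dM]|->]; last by split.
  by apply/eqP; rewrite eq_sym eqEdim SM dM /=.
have [|u uV uS] := @exists_notin (S + <[v]>)%VS V.
  by rewrite dim_add_line // dV addnS; lia.
have vSu a : v \notin (S + <[u + a *: v]>)%VS.
  apply: contra uS => /memv_addP[s sS [w /vlineP[k ->] ev]].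
  have k0 : k != 0.
    by apply: contraNneq vS => k0; rewrite ev k0 scale0r addr0.
  have -> : u = - k^-1 *: s + (k^-1 - a) *: v.
    have e : k^-1 *: v = k^-1 *: s + (u + a *: v).
      by rewrite {1}ev scalerDr scalerA mulVf // scale1r.
    by rewrite scalerBl e scaleNr (addrA (- _)) addKr addrK.
  by rewrite memv_add ?memvZ ?memv_line.
rewrite -sum1_card.
transitivity (\sum_(M in hyperplanes_avoiding S V v) \sum_(a : F | (u + a *: v)%R \in M) 1)%N.
  apply: eq_bigr => M; rewrite inE => /and4P[SM MV vM /eqP dM].
  have : u \in (M + <[v]>)%VS by rewrite (hyperplane_add_line MV).
  case/memv_addP => m mM [w /vlineP[k ->] eu].
  rewrite sum1_card -[LHS](card1 (- k)); apply/esym/eq_card => a.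
  rewrite [RHS]inE -[LHS]/(u + a *: v \in M).
  apply/idP/eqP => [|->]; last by rewrite scaleNr eu addrK.
  rewrite eu -addrA -scalerDl => /(memvB mM); rewrite opprD addNKr memvN => kaM.
  apply/eqP; rewrite -subr_eq0 opprK addrC; apply: contraNT vM => ka0.
  by rewrite -(scalerK ka0 v) memvZ.
rewrite (exchange_big_dep predT) //=.
rewrite expnS -sum_nat_const; apply: eq_bigr => a _.
rewrite sum1_card -(IHn (S + <[u + a *: v]>)%VS) //.
- apply: eq_card => M; rewrite [RHS]inE subv_add_line unfold_in /= inE.
  by case: (_ + _ \in M); rewrite ?andbT ?andbF.
- by rewrite subv_add_line SV memvD ?memvZ.
- rewrite dim_add_line ?dV ?addSnnS //; apply: contra uS => uaS.
  by rewrite -(addrK (a *: v) u) -scaleNr memv_add ?memvZ ?memv_line.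
Qed.

Definition codim_subspaces S U e : {set {vspace vT}} :=
  [set T | [&& (S <= T)%VS, (T <= U)%VS & (\dim T + e == \dim U)%N]].

(** Fix [v] in [U] outside [S]. The subspaces containing [v] are those through [S + <[v]>]; any
    other [T] is a hyperplane avoiding [v] in [W = T + <[v]>], and each [W] arises from
    [q ^ (n - e)] of them. This is the Pascal rule of [qbin]. *)
Lemma card_codim_subspaces n e S U :
  (S <= U)%VS -> \dim U = (\dim S + n)%N -> #|codim_subspaces S U e| = qbin q n e.
Proof.
elim: n e S => [|n IHn] [|e] S SU dU.
- rewrite qbinn0 (_ : codim_subspaces _ _ _ = [set U]) ?cards1 //.
  apply/setP => T; rewrite !inE addn0; apply/and3P/eqP => [[_ TU /eqP dT]|->]; last by split.
  by apply/eqP; rewrite eqEdim TU dT /=.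
- apply/eqP; rewrite cards_eq0; apply/eqP/setP => T; rewrite !inE; apply/and3P => -[ST _ /eqP dT].
  by have := dimvS ST; lia.
- rewrite qbinn0 (_ : codim_subspaces _ _ _ = [set U]) ?cards1 //.
  apply/setP => T; rewrite !inE addn0; apply/and3P/eqP => [[_ TU /eqP dT]|->]; last by split.
  by apply/eqP; rewrite eqEdim TU dT /=.
have [|v vU vS] := @exists_notin S U; first by rewrite dU; lia.
have PU : (S + <[v]> <= U)%VS by rewrite subv_add_line SU vU.
have dP : \dim U = (\dim (S + <[v]>) + n)%N by rewrite dim_add_line // dU addnS.
rewrite -(cardsID [set T : {vspace vT} | v \in T]) qbinS; congr addn.
  rewrite -(IHn _ (S + <[v]>)%VS) //; apply: eq_card => T.
  by rewrite !inE subv_add_line; case: (_ \in T); rewrite ?andbT ?andbF.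
transitivity (\sum_(W in codim_subspaces (S + <[v]>) U e) #|hyperplanes_avoiding S W v|)%N.
  rewrite -sum1_card (partition_big (fun T => (T + <[v]>)%VS)
    (mem (codim_subspaces (S + <[v]>) U e))) /=.
    apply: eq_bigr => W; rewrite !inE => /and3P[PW WU /eqP dW].
    rewrite sum1_card; apply: eq_card => T; rewrite [RHS]inE unfold_in /= !inE.
    have vW : v \in W by move: PW; rewrite subv_add_line => /andP[].
    apply/andP/and4P=> [[/and4P[vT' ST TU /eqP dT] /eqP <-]|[ST TW vT' /eqP dT]].
      by split; rewrite ?addvSl // dim_add_line.
    split; last by rewrite (hyperplane_add_line TW).
    by rewrite vT' ST (subv_trans TW WU) /=; clear -dT dW; lia.
  move=> T; rewrite !inE => /and4P[vT' ST TU /eqP dT].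
  by rewrite addvS // subv_add_line TU vU dim_add_line // addSnnS dT /=.
rewrite -(IHn e _ PU dP) mulnC -sum_nat_const; apply: eq_bigr => W.
rewrite !inE => /and3P[PW WU /eqP dW]; apply: card_hyperplanes_avoiding => //.
- by apply: subv_trans PW; rewrite addvSl.
- by move: PW; rewrite subv_add_line => /andP[].
- by have := dimvS PW; rewrite dim_add_line //; lia.
Qed.

Lemma sum_subspaces (R : pzRingType) S U (f : nat -> R) : (S <= U)%VS ->
  \sum_(T | (S <= T)%VS && (T <= U)%VS) f (\dim U - \dim T)%N =
  \sum_(e < (\dim U - \dim S).+1) (qbin q (\dim U - \dim S) e)%:R * f e.
Proof.
move=> SU; have dSU := dimvS SU.
rewrite (partition_big (fun T => inord (\dim U - \dim T) : 'I_(\dim U - \dim S).+1) predT) //=.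
apply: eq_bigr => e _; have e_le : (e <= \dim U - \dim S)%N by rewrite -ltnS ltn_ord.
rewrite -(card_codim_subspaces e SU) ?subnKC // mulr_natl -sumr_const.
apply: eq_big => [T|T /andP[/andP[ST TU] /eqP <-]]; last first.
  by rewrite inordK // ltnS leq_sub2l // dimvS.
rewrite [RHS]inE andbA; case ST : (S <= T)%VS; case TU : (T <= U)%VS => //=.
have dTU := dimvS TU; have dST := dimvS ST.
apply/eqP/eqP => [<-|eT]; first by rewrite inordK ?subnKC // ltnS leq_sub2l.
by apply: val_inj => /=; rewrite inordK -?eT ?addKn //; lia.
Qed.

End SubspaceCounts.

(** * The quadric *)

Section PolarSpace.
Variables (F : finFieldType) (d : nat).
Local Notation V := 'rV[F]_(d + d).
Local Notation q := #|F|.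
Implicit Types (u v w : V) (U W S T M A B C : {vspace V}).

Lemma dim_full : \dim {:V} = (d + d)%N.
Proof. by rewrite dimvf dim_matrix; apply: mul1n. Qed.

Definition polar u v : F :=
  \sum_(j < d) (u 0 (lshift d j) * v 0 (rshift d j) + u 0 (rshift d j) * v 0 (lshift d j)).

Lemma hyp_formD u v : hyp_form (u + v) = hyp_form u + hyp_form v + polar u v.
Proof.
rewrite /hyp_form /polar -!big_split /=; apply: eq_bigr => j _.
by rewrite !mxE; ring.
Qed.

Lemma hyp_formZ a v : hyp_form (a *: v) = a ^+ 2 * hyp_form v.
Proof.
by rewrite /hyp_form mulr_sumr; apply: eq_bigr => j _; rewrite !mxE; ring.
Qed.

Lemma polarC u v : polar u v = polar v u.
Proof. by apply: eq_bigr => j _; ring. Qed.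

Lemma polarDr u v w : polar u (v + w) = polar u v + polar u w.
Proof.
by rewrite /polar -big_split /=; apply: eq_bigr => j _; rewrite !mxE; ring.
Qed.

Lemma polarZr a u v : polar u (a *: v) = a * polar u v.
Proof.
by rewrite /polar mulr_sumr; apply: eq_bigr => j _; rewrite !mxE; ring.
Qed.

Lemma polarDl u v w : polar (u + v) w = polar u w + polar v w.
Proof. by rewrite polarC polarDr !(polarC w). Qed.

Lemma polarZl a u v : polar (a *: u) v = a * polar u v.
Proof. by rewrite polarC polarZr polarC. Qed.

Lemma polar_suml I (r : seq I) (P : pred I) (E : I -> V) v :
  polar (\sum_(i <- r | P i) E i) v = \sum_(i <- r | P i) polar (E i) v.
Proof.
apply: (big_morph (polar^~ v)) => [u w|]; first exact: polarDl.
by rewrite -(scale0r (0 : V)) polarZl mul0r.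
Qed.

(** Pairing with the unit vector of the partner coordinate reads off each coordinate of [v]. *)
Lemma polar_nondegenerate v : (forall u, polar u v = 0) -> v = 0.
Proof.
have deltaE (k j : 'I_(d + d)) : (delta_mx 0 k : V) 0 j = (j == k)%:R by rewrite mxE eqxx.
move=> v0; apply/rowP => k; rewrite mxE.
case: (splitP k) => j ek.
  have -> : k = lshift d j by apply: val_inj.
  rewrite -(v0 (delta_mx 0 (rshift d j))) /polar (bigD1 j) //= !deltaE eqxx eq_lrshift.
  rewrite mul0r mul1r add0r big1 ?addr0 // => i nij.
  by rewrite !deltaE eq_lrshift (inj_eq (@rshift_inj _ _)) (negPf nij) !mul0r addr0.
have -> : k = rshift d j by apply: val_inj.
rewrite -(v0 (delta_mx 0 (lshift d j))) /polar (bigD1 j) //= !deltaE eqxx eq_rlshift.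
rewrite mul0r mul1r addr0 big1 ?addr0 // => i nij.
by rewrite !deltaE eq_rlshift (inj_eq (@lshift_inj _ _)) (negPf nij) !mul0r addr0.
Qed.

(* The image lies in U, so rank-nullity bounds \dim (perp U) from below. *)
Definition perp_map U (v : V) : V :=
  \sum_(k < \dim U) polar (vbasis U)`_k v *: (vbasis U)`_k.

Fact perp_map_is_linear U : linear (perp_map U).
Proof.
move=> a u v; rewrite /perp_map scaler_sumr -big_split /=; apply: eq_bigr => k _.
by rewrite polarDr polarZr scalerDl scalerA.
Qed.
HB.instance Definition _ U :=
  GRing.isLinear.Build F V V *:%R (perp_map U) (perp_map_is_linear U).

Definition perp U : {vspace V} := lker (linfun (perp_map U)).

Lemma perpP U v : reflect (forall u, u \in U -> polar u v = 0) (v \in perp U).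
Proof.
rewrite memv_ker lfunE /=; apply: (iffP eqP) => [uv0 u|v0]; last first.
  by rewrite /perp_map big1 // => k _; rewrite v0 ?scale0r // vbasis_mem // memt_nth.
move=> /coord_vbasis->; rewrite polar_suml big1 // => k _; rewrite polarZl.
have /freeP/(_ _ uv0 k) -> := basis_free (vbasisP U).
by rewrite mulr0.
Qed.

Lemma dim_perp_ge U : (d + d <= \dim (perp U) + \dim U)%N.
Proof.
have := limg_ker_dim (linfun (perp_map U)) fullv.
rewrite capfv dim_full => e; apply: (leq_trans (eq_leq (esym e))); rewrite leq_add2l.
apply: dimvS; apply/subvP => _ /memv_imgP[v _ ->]; rewrite lfunE /=.
by apply: rpred_sum => k _; rewrite memvZ // vbasis_mem // memt_nth.
Qed.

Lemma perp_add U W : perp (U + W) = (perp U :&: perp W)%VS.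
Proof.
apply/vspaceP => v; rewrite memv_cap; apply/perpP/andP => [v0|[/perpP vU /perpP vW]].
  split; apply/perpP => u uU; apply: v0; first exact: (subvP (addvSl U W)).
  exact: (subvP (addvSr U W)).
by move=> _ /memv_addP[u uU [w wW ->]]; rewrite polarDl vU // vW // addr0.
Qed.

Lemma perp_full : perp fullv = 0%VS.
Proof.
apply/eqP; rewrite -subv0; apply/subvP => v /perpP v0; rewrite memv0.
by apply/eqP/polar_nondegenerate => u; rewrite v0 ?memvf.
Qed.

(** The perps of [U] and of its complement meet in [perp fullv = 0], so their dimensions add up to
    at most [d + d]; the lower bounds of [dim_perp_ge] must then both be equalities. *)
Lemma dim_perp U : (\dim (perp U) + \dim U)%N = (d + d)%N.
Proof.
have U0 := dim_perp_ge U; have UC0 := dim_perp_ge U^C.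
have := dimv_sum_cap (perp U) (perp U^C).
rewrite -perp_add addv_complf perp_full dimv0 addn0.
have := dimvS (subvf (perp U + perp U^C)).
rewrite dim_full; rewrite dimv_compl dim_full in UC0.
have := dimvS (subvf U); rewrite dim_full; lia.
Qed.

Lemma perpS U W : (U <= W)%VS -> (perp W <= perp U)%VS.
Proof. by move=> /subvP UW; apply/subvP => v /perpP v0; apply/perpP => u /UW; apply: v0. Qed.

Lemma totally_singularP U :
  reflect (forall v, v \in U -> hyp_form v = 0) (totally_singular U).
Proof.
apply: (iffP forallP) => [Us v vU|Us v]; first by apply/eqP; have /implyP := Us v; apply.
by apply/implyP => /Us ->.
Qed.

Lemma totally_singularS U W : (U <= W)%VS -> totally_singular W -> totally_singular U.
Proof. by move=> /subvP UW /totally_singularP Ws; apply/totally_singularP => v /UW/Ws. Qed.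

Lemma sub_perp U : totally_singular U -> (U <= perp U)%VS.
Proof.
move=> /totally_singularP Us; apply/subvP => v vU; apply/perpP => u uU.
by have := hyp_formD u v; rewrite !Us ?memvD // !add0r => <-.
Qed.

Lemma totally_singular_add U W :
  totally_singular U -> totally_singular W -> (W <= perp U)%VS -> totally_singular (U + W).
Proof.
move=> /totally_singularP Us /totally_singularP Ws /subvP WU; apply/totally_singularP.
move=> _ /memv_addP[u uU [w wW ->]]; rewrite hyp_formD Us // Ws // !add0r.
by apply: (perpP _ _ (WU _ wW)).
Qed.

Lemma generatorsP U : reflect (totally_singular U /\ \dim U = d) (U \in generators F d).
Proof. by rewrite inE; apply: (iffP andP) => -[-> /eqP]. Qed.

Lemma generator_perp A : A \in generators F d -> perp A = A.
Proof.
move=> /generatorsP[As dA]; apply/esym/eqP; rewrite eqEdim sub_perp //=.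
by have := dim_perp A; lia.
Qed.

Lemma dim_cap_perp A S : A \in generators F d ->
  (\dim (A :&: perp S) + \dim S)%N = (d + \dim (A :&: S))%N.
Proof.
move=> Ag; rewrite -{1}(generator_perp Ag) -perp_add.
have := dim_perp (A + S); have := dimv_sum_cap A S.
by have [_ ->] := generatorsP _ Ag; lia.
Qed.

(** For a totally singular [S] this is the gate of the generator [A] among the generators through
    [S]: by [dim_cap_project], passing from [A] to it lowers the codimension of the meet with every
    such generator by the same amount. *)
Definition project A S : {vspace V} := (A :&: perp S + S)%VS.

Lemma project_generator A S :
  A \in generators F d -> totally_singular S -> project A S \in generators F d.
Proof.
move=> Ag Ss; have [As dA] := generatorsP _ Ag; apply/generatorsP; split.
  rewrite /project addvC; apply: totally_singular_add => //; last exact: capvSr.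
  exact: totally_singularS (capvSl _ _) As.
have := dimv_sum_cap (A :&: perp S) S; have := dim_cap_perp S Ag.
by rewrite -capvA (capv_idPr (sub_perp Ss)) /project; lia.
Qed.

Lemma generator_sub A S : A \in generators F d -> (S <= A)%VS -> (A <= perp S)%VS.
Proof. by move=> Ag /perpS; rewrite generator_perp. Qed.

Lemma generators_eq A B :
  A \in generators F d -> B \in generators F d -> (A <= B)%VS -> A = B.
Proof.
move=> /generatorsP[_ dA] /generatorsP[_ dB] AB.
by apply/eqP; rewrite eqEdim AB dA dB /=.
Qed.

End PolarSpace.

(** * Adjacent generators and the parity of intersections *)

Section DualPolarGraph.
Variables (F : finFieldType) (d : nat).
Local Notation V := 'rV[F]_(d + d).
Local Notation q := #|F|.
Local Notation gens := (generators F d).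
Implicit Types (u v w : V) (U W S T M A B C : {vspace V}).

Lemma totally_singular_line v : hyp_form v = 0 -> totally_singular <[v]>%VS.
Proof. by move=> v0; apply/totally_singularP => _ /vlineP[k ->]; rewrite hyp_formZ v0 mulr0. Qed.

(** The quotient of [perp M] by [M] is a hyperbolic line, which has exactly two singular points: one
    is [A], the other gives [B]. *)
Lemma other_generator M A : A \in gens -> (M <= A)%VS -> (\dim M).+1 = d ->
  exists B, [/\ B \in gens, (M <= B)%VS, B != A &
    forall v, v \in perp M -> hyp_form v = 0 -> v \in A \/ v \in B].
Proof.
move=> Ag MA dM; have [As dA] := generatorsP _ Ag.
have dpM : \dim (perp M) = d.+1 by have := dim_perp M; lia.
have ApM := generator_sub Ag MA.
have [|w wM wA] := @exists_notin _ _ A (perp M); first by rewrite dA dpM.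
have [|r rA rM] := @exists_notin _ _ M A; first by lia.
have eA : (M + <[r]>)%VS = A by apply: hyperplane_add_line; rewrite ?dA.
have rw0 : polar r w != 0.
  apply: contraNneq wA => rw0; rewrite -(generator_perp Ag); apply/perpP => u.
  rewrite -eA => /memv_addP[m mM [_ /vlineP[k ->] ->]].
  by rewrite polarDl polarZl rw0 (perpP _ _ wM) // mulr0 addr0.
have rr0 : polar r r = 0 by apply: (perpP _ _ _ _ rA); apply: (subvP (sub_perp As)).
have r0 : hyp_form r = 0 by have /totally_singularP := As; apply.
(* Adding [t *: r] to [w] changes the form by [t * polar r w], because [r] is singular; this choice
   of [t] makes [w'] singular. *)
pose w' := w + (- (hyp_form w / polar r w)) *: r.
have w'0 : hyp_form w' = 0.
  by rewrite hyp_formD hyp_formZ r0 mulr0 addr0 polarZr (polarC w r) mulNr divfK // subrr.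
have rw' : polar r w' != 0 by rewrite polarDr polarZr rr0 mulr0 addr0.
have w'M : w' \in perp M by rewrite memvD // memvZ // (subvP ApM).
have w'A : w' \notin A.
  apply: contra wA => w'A.
  by rewrite -(addrK (- (hyp_form w / polar r w) *: r) w) memvB // memvZ.
exists (M + <[w']>)%VS; split.
- apply/generatorsP; split.
    apply: totally_singular_add; first exact: totally_singularS As.
      exact: totally_singular_line.
    by rewrite -memvE.
  by rewrite dim_add_line //; apply: contra w'A; apply: subvP.
- exact: addvSl.
- by apply: contraNneq w'A => <-; rewrite (subvP (addvSr _ _)) // memv_line.
have epM : (A + <[w']>)%VS = perp M by apply: hyperplane_add_line; rewrite ?dA ?dpM.
move=> v; rewrite -epM -{1}eA.
case/memv_addP => _ /memv_addP[m mM [_ /vlineP[a ->] ->]] [_ /vlineP[b ->] ->].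
have arA : m + a *: r \in A by rewrite memvD ?memvZ // (subvP MA).
(* On [m + a *: r + b *: w'] the form takes the value [a * b * polar r w'], so [a] or [b] is 0. *)
rewrite hyp_formD hyp_formZ w'0 mulr0 addr0 polarZr polarDl polarZl.
have /totally_singularP/(_ _ arA) -> := As.
rewrite (perpP _ _ w'M) // !add0r => /eqP; rewrite !mulf_eq0 (negPf rw') orbF.
case/orP => /eqP ->; rewrite scale0r addr0; [by left | right].
by rewrite memv_add ?memvZ ?memv_line.
Qed.

(** Any second generator through [M] is the one found in [other_generator]: a vector of [B] outside
    [M] is singular and not in [A], so it lies in [C], and [B = C]. *)
Lemma two_generators M A B : A \in gens -> B \in gens -> A != B ->
  (M <= A)%VS -> (M <= B)%VS -> (\dim M).+1 = d ->
  forall v, v \in perp M -> hyp_form v = 0 -> v \in A \/ v \in B.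
Proof.
move=> Ag Bg AB MA MB dM.
have [C [Cg MC CA AC]] := other_generator Ag MA dM.
have [Bs dB] := generatorsP _ Bg.
have [|b bB bM] := @exists_notin _ _ M B; first by lia.
have eB : (M + <[b]>)%VS = B by apply: hyperplane_add_line; rewrite ?dB.
have [|||bC] := AC b.
- by apply: (subvP (generator_sub Bg MB)).
- by have /totally_singularP := Bs; apply.
- move=> bA; case/eqP: AB; apply/esym; apply: generators_eq => //.
  by rewrite -eB subv_add_line MA.
suff -> : B = C by [].
by apply: generators_eq => //; rewrite -eB subv_add_line MC.
Qed.

Lemma adjacent_generators_cap M A B : A \in gens -> B \in gens -> A != B ->
  (M <= A)%VS -> (M <= B)%VS -> (\dim M).+1 = d -> (A :&: B)%VS = M.
Proof.
move=> Ag Bg AB MA MB dM; apply/esym/eqP; rewrite eqEdim subv_cap MA MB /=.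
have [_ dA] := generatorsP _ Ag; suff : (\dim (A :&: B) < \dim A)%N by lia.
rewrite ltn_neqAle dimvS ?capvSl // andbT.
apply: contraNneq AB => dAB; apply/eqP; apply: generators_eq => //; apply/capv_idPl/eqP.
by rewrite eqEdim capvSl dAB /=.
Qed.

Lemma third_generator M A B C : A \in gens -> B \in gens -> C \in gens ->
  A != B -> A != C ->
  (M <= A)%VS -> (M <= B)%VS -> (M <= C)%VS -> (\dim M).+1 = d -> B = C.
Proof.
move=> Ag Bg Cg AB AC MA MB MC dM.
have [Bs dB] := generatorsP _ Bg.
have [|b bB bM] := @exists_notin _ _ M B; first by lia.
have eB : (M + <[b]>)%VS = B by apply: hyperplane_add_line; rewrite ?dB.
have [||bA|bC] := two_generators Ag Cg AC MA MC dM (v := b).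
- by apply: (subvP (generator_sub Bg MB)).
- by have /totally_singularP := Bs; apply.
- by case/negP: bM; rewrite -(adjacent_generators_cap Ag Bg AB MA MB dM) memv_cap bA.
- by apply: generators_eq => //; rewrite -eB subv_add_line MC.
Qed.

(** [A :&: perp M] exceeds [A :&: M] by one dimension. The extra singular vector lies in [B] or in
    [C] by [two_generators], and not in both since [B :&: C = M]. *)
Lemma cap_adjacent_generators M A B C : A \in gens -> B \in gens -> C \in gens -> B != C ->
  (M <= B)%VS -> (M <= C)%VS -> (\dim M).+1 = d ->
  (\dim (A :&: B) = (\dim (A :&: M)).+1 /\ (A :&: C = A :&: M)%VS) \/
  (\dim (A :&: C) = (\dim (A :&: M)).+1 /\ (A :&: B = A :&: M)%VS).
Proof.
move=> Ag.
wlog suff W : B C / B \in gens -> C \in gens -> B != C ->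
  (M <= B)%VS -> (M <= C)%VS -> (\dim M).+1 = d ->
  forall a, a \in A -> a \in perp M -> a \notin M -> a \in B ->
  \dim (A :&: B) = (\dim (A :&: M)).+1 /\ (A :&: C = A :&: M)%VS.
  move=> Bg Cg BC MB MC dM.
  have dAM := dim_cap_perp M Ag.
  have [|a] := @exists_notin _ _ (A :&: M)%VS (A :&: perp M)%VS; first by lia.
  rewrite !memv_cap => /andP[aA aM]; rewrite aA /= => aM'.
  have [As _] := generatorsP _ Ag.
  have [|aB|aC] := two_generators Bg Cg BC MB MC dM aM.
  - by have /totally_singularP := As; apply.
  - by left; apply: (W B C _ _ _ _ _ _ a).
  - by right; apply: (W C B _ _ _ _ _ _ a) => //; rewrite eq_sym.
move=> Bg Cg BC MB MC dM a aA aM aM' aB.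
have dAM := dim_cap_perp M Ag.
have eAM : (A :&: M + <[a]>)%VS = (A :&: perp M)%VS.
  apply: hyperplane_add_line; rewrite ?memv_cap ?aA ?aM ?aM' //.
    by rewrite capvS // sub_perp //; have [Bs _] := generatorsP _ Bg; apply: totally_singularS Bs.
  by clear -dAM dM; lia.
have eAB : (A :&: B)%VS = (A :&: perp M)%VS.
  apply/eqP; rewrite eqEsubv capvS ?(generator_sub Bg) //= -eAM subv_add_line.
  by rewrite capvS //= memv_cap aA aB.
split; first by rewrite eAB; clear -dAM dM; lia.
apply/eqP; rewrite eqEsubv (capvS (subvv A) MC) andbT subv_cap capvSl /=.
rewrite -(adjacent_generators_cap Bg Cg BC MB MC dM) subv_cap capvSr andbT.
by rewrite (subv_trans (capvS (subvv A) (generator_sub Cg MC))) // -eAB capvSr.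
Qed.

(** A step in the graph of generators: being its own perp, [A] is cut in a hyperplane by the perp of
    any point outside it, and that hyperplane together with [p] spans an adjacent generator. *)
Lemma project_line A p (B := project A <[p]>) (M := (A :&: perp <[p]>)%VS) :
  A \in gens -> hyp_form p = 0 -> p \notin A ->
  [/\ B \in gens, A != B, p \in B, (M <= A)%VS & (M <= B)%VS] /\ (\dim M).+1 = d.
Proof.
move=> Ag p0 pA; have pB : p \in B by rewrite (subvP (addvSr _ _)) // memv_line.
split; first split.
- by apply: project_generator => //; apply: totally_singular_line.
- by apply: contraNneq pA => ->.
- exact: pB.
- exact: capvSl.
- exact: addvSl.
have := dim_cap_perp <[p]> Ag; rewrite -/M.
have -> : (A :&: <[p]>)%VS = 0%VS.
  apply/eqP; rewrite -subv0; apply/subvP => v; rewrite memv_cap memv0 => /andP[vA /vlineP[k ev]].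
  apply: contraNT pA => v0; have k0 : k != 0 by apply: contraNneq v0 => k0; rewrite ev k0 scale0r.
  by rewrite -(scalerK k0 p) -ev memvZ.
rewrite dimv0 dim_vline; suff -> : p != 0 by lia.
by apply: contraNneq pA => ->; rewrite mem0v.
Qed.

(* Move from B to C through adjacent generators: every step changes both
   \dim (A :&: B) and \dim (B :&: C) by one. *)
Lemma odd_dim_cap A B C : A \in gens -> B \in gens -> C \in gens ->
  odd (\dim (A :&: B) + \dim (A :&: C) + \dim (B :&: C)) = odd d.
Proof.
move=> Ag Bg Cg; have [n] := ubnP (d - \dim (B :&: C)); elim: n B Bg => // n IHn B Bg ltn.
have [_ dB] := generatorsP _ Bg; have [Cs dC] := generatorsP _ Cg.
have [CB|/subvPn[c cC cB]] := boolP (C <= B)%VS.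
  by rewrite (generators_eq Cg Bg CB) capvv dB addnn oddD odd_double.
have c0 : hyp_form c = 0 by have /totally_singularP := Cs; apply.
have [] := project_line Bg c0 cB; set B' := project _ _; set M := (_ :&: perp _)%VS.
move=> [B'g BB' cB' MB MB'] dM.
have cM : c \notin M by apply: contra cB; apply: subvP.
have [[_ e]|[eCB' eCB]] := cap_adjacent_generators Cg Bg B'g BB' MB MB' dM.
  have : c \in (C :&: B')%VS by rewrite memv_cap cC.
  by rewrite e memv_cap (negPf cM) andbF.
have := IHn B' B'g; rewrite capvC in ltn.
rewrite (capvC B') (capvC B) eCB' eCB => IH.
have := dimvS (capvSl C B'); rewrite eCB' dC => le.
have {}IH : odd (\dim (A :&: B') + \dim (A :&: C) + (\dim (C :&: M)).+1) = odd d.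
  by apply: IH; rewrite eCB in ltn; clear -ltn le; lia.
move: IH; have [[-> ->]|[-> ->]] := cap_adjacent_generators Ag Bg B'g BB' MB MB' dM => <-.
  by rewrite addSn addnS.
by rewrite addSn addnS addSn /= negbK.
Qed.

End DualPolarGraph.

(** * Counts of generators *)

Section GeneratorCounts.
Variables (F : finFieldType) (d : nat).
Local Notation V := 'rV[F]_(d + d).
Local Notation q := #|F|.
Local Notation gens := (generators F d).
Implicit Types (u v w : V) (U W S T M A B C : {vspace V}).

Definition generators_meeting A T : {set {vspace V}} :=
  [set B in gens | (B :&: A)%VS == T].

Lemma generators_meetingP A T B :
  reflect (B \in gens /\ (B :&: A)%VS = T) (B \in generators_meeting A T).
Proof. by rewrite [X in reflect _ X]inE; apply: (iffP andP) => -[-> /eqP]. Qed.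

(** Since [p] is in [A], the modular law moves the intersection with [A] inside the sum [B :&: perp
    <[p]> + <[p]>], which leaves [T + <[p]>]. *)
Lemma project_meeting A T B p : A \in gens -> (T <= A)%VS -> p \in A -> p \notin T ->
  B \in generators_meeting A T ->
  [/\ project B <[p]> \in generators_meeting A (T + <[p]>), p \notin B,
    (T <= B :&: perp <[p]>)%VS & (B :&: project B <[p]>)%VS = (B :&: perp <[p]>)%VS].
Proof.
move=> Ag TA pA pT /generators_meetingP[Bg BA].
have [As dA] := generatorsP _ Ag.
have p0 : hyp_form p = 0 by have /totally_singularP := As; apply.
have pB : p \notin B by apply: contra pT => pB; rewrite -BA memv_cap pB.
have [[B'g BB' pB' MB MB'] dM] := project_line Bg p0 pB.
have TM : (T <= B :&: perp <[p]>)%VS.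
  rewrite subv_cap -{1}BA capvSl /=; apply: subv_trans TA _.
  by apply: generator_sub; rewrite -?memvE.
split=> //; last exact: adjacent_generators_cap.
apply/generators_meetingP; split=> //.
rewrite /project capvC -vspace_modr -?memvE //; congr (_ + _)%VS.
apply/eqP; rewrite eqEsubv subv_cap TA TM /= andbT -BA subv_cap capvSl andbT.
by rewrite (subv_trans (capvSr _ _)) ?capvSl.
Qed.

(* For p in A outside T, project^~ <[p]> maps the generators meeting A in T to
   those meeting A in T + <[p]>; B |-> B :&: C identifies the fibre over C with
   the hyperplanes of C containing T and avoiding p. *)
Lemma card_generators_meeting n A T : A \in gens -> (T <= A)%VS -> (\dim T + n)%N = d ->
  #|generators_meeting A T| = (q ^ 'C(n, 2))%N.
Proof.
elim: n T => [|n IHn] T Ag TA dT; have [As dA] := generatorsP _ Ag.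
  rewrite bin0n expn0 (_ : generators_meeting _ _ = [set A]) ?cards1 //.
  have -> : T = A by apply/eqP; rewrite eqEdim TA dA /=; lia.
  apply/setP => B; rewrite [LHS]inE [RHS]inE; apply/andP/eqP => [[Bg /eqP BA]|->].
    by apply/esym; apply: generators_eq => //; rewrite -BA capvSl.
  by rewrite Ag capvv.
have [|p pA pT] := @exists_notin _ _ T A; first by lia.
have p0 : hyp_form p = 0 by have /totally_singularP := As; apply.
have T1A : (T + <[p]> <= A)%VS by rewrite subv_add_line TA.
transitivity (\sum_(C in generators_meeting A (T + <[p]>)) q ^ n)%N; last first.
  rewrite sum_nat_const IHn //; last by rewrite dim_add_line // addSnnS.
  by rewrite binS bin1 expnD mulnC.
rewrite -sum1_card (partition_big (fun B => project B <[p]>)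
  (mem (generators_meeting A (T + <[p]>)))) /=; last first.
  by move=> B BX; have [] := project_meeting Ag TA pA pT BX.
apply: eq_bigr => C CX; have /generators_meetingP[Cg CA] := CX.
have [Cs dC] := generatorsP _ Cg.
have /andP[TC pC] : (T <= C)%VS && (p \in C).
  by rewrite -subv_add_line -CA capvSl.
rewrite -(@card_hyperplanes_avoiding _ _ n T C p) //; last by rewrite dC; clear -dT; lia.
rewrite sum1_card -[LHS](card_in_imset (f := fun B => (B :&: C)%VS)).
  apply: eq_card => M; rewrite [RHS]inE dC.
  apply/imsetP/and4P => [[B /andP[BX /eqP eC] ->]|[TM MC pM /eqP dM]].
    have [_ pB TB] := project_meeting Ag TA pA pT BX.
    have [[_ _ _ _ _] dM] := project_line (proj1 (generators_meetingP _ _ _ BX)) p0 pB.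
    rewrite eC => ->; split=> //; last by rewrite dM.
      by rewrite -eC addvSl.
    by rewrite memv_cap (negPf pB).
  (* Surjectivity: the preimage of a hyperplane [M] of [C] is the second generator through [M]. *)
  have [B [Bg MB BC _]] := other_generator Cg MC dM.
  have pB : p \notin B.
    apply: contra BC => pB; apply/eqP/esym; apply: generators_eq => //.
    by rewrite -(hyperplane_add_line MC pC pM) ?dC // subv_add_line MB.
  have BCM := adjacent_generators_cap Bg Cg BC MB MC dM.
  exists B; last by rewrite BCM.
  apply/andP; split.
    apply/generators_meetingP; split=> //.
    have [[_ e]|[eC eB]] := cap_adjacent_generators Ag Bg Cg BC MB MC dM.
      have : p \in (A :&: M)%VS by rewrite -e memv_cap pA.
      by rewrite memv_cap (negPf pM) andbF.
    rewrite capvC eB; apply/esym/eqP; rewrite eqEdim subv_cap TA TM /=.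
    by move: eC; rewrite capvC CA dim_add_line // => -[->].
  apply/eqP/esym; apply: generators_eq => //.
    by apply: project_generator => //; apply: totally_singular_line.
  rewrite -(hyperplane_add_line MC pC pM) ?dC //; apply: addvS => //.
  by rewrite subv_cap MB (subv_trans MC) // generator_sub // -memvE.
(* Injectivity: [B1] and [B2] are both the generator other than [C] through the hyperplane
   [B1 :&: C]. *)
move=> B1 B2 /andP[B1X /eqP e1] /andP[B2X /eqP e2] /= e12.
have [B1g _] := generators_meetingP _ _ _ B1X; have [B2g _] := generators_meetingP _ _ _ B2X.
have [_ pB1 _ _] := project_meeting Ag TA pA pT B1X.
have [_ pB2 _ _] := project_meeting Ag TA pA pT B2X.
have [[_ CB1 _ _ _] dM1] := project_line B1g p0 pB1.
have [[_ CB2 _ _ _] _] := project_line B2g p0 pB2.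
have [_ _ _ eM1] := project_meeting Ag TA pA pT B1X.
rewrite -eM1 e1 in dM1.
apply: (third_generator Cg B1g B2g _ _ _ _ _ dM1).
- by rewrite eq_sym -e1.
- by rewrite eq_sym -e2.
- exact: capvSr.
- exact: capvSl.
- by rewrite e12 capvSl.
Qed.

(** Group the generators by their meet [T] with [A]: [T] runs over the subspaces between [S] and
    [A], and [card_generators_meeting] gives the size of each group. *)
Lemma sum_generators_sub (R : pzRingType) A S (f : nat -> R) : A \in gens -> (S <= A)%VS ->
  \sum_(B in gens | (S <= B)%VS) f (d - \dim (B :&: A))%N =
  \sum_(e < (d - \dim S).+1) (qbin q (d - \dim S) e * q ^ 'C(e, 2))%:R * f e.
Proof.
move=> Ag SA; have [As dA] := generatorsP _ Ag; have dSA := dimvS SA; rewrite dA in dSA.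
rewrite (partition_big (fun B => (B :&: A)%VS)
  (fun T => (S <= T)%VS && (T <= A)%VS)) /=; last first.
  by move=> B /andP[_ SB]; rewrite subv_cap SB SA capvSr.
transitivity (\sum_(T | (S <= T)%VS && (T <= A)%VS) (q ^ 'C(d - \dim T, 2))%:R * f (d - \dim T)%N).
  apply: eq_bigr => T /andP[ST TA].
  have dTA := dimvS TA; rewrite dA in dTA.
  rewrite -(card_generators_meeting Ag TA) ?subnKC // mulr_natl -sumr_const.
  apply: eq_big => [B|B /andP[_ /eqP->] //].
  rewrite [RHS]inE; case: (B \in gens) => //=; apply: andb_idl => /eqP e.
  by apply: subv_trans ST _; rewrite -e capvSl.
have := sum_subspaces (fun e => (q ^ 'C(e, 2))%:R * f e) SA; rewrite dA => ->.
by apply: eq_bigr => e _; rewrite natrM mulrA.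
Qed.

(** As [B] lies in [perp S], the modular law gives [B :&: project A S = B :&: A + S]. *)
Lemma dim_cap_project A B S : B \in gens -> totally_singular S -> (S <= B)%VS ->
  (\dim (B :&: project A S) + \dim (S :&: A))%N = (\dim (B :&: A) + \dim S)%N.
Proof.
move=> Bg Ss SB; rewrite /project -vspace_modr // capvA.
have -> : (B :&: A :&: perp S = B :&: A)%VS.
  by apply/capv_idPl; apply: subv_trans (capvSl _ _) (generator_sub Bg SB).
rewrite -[RHS]dimv_sum_cap; congr addn; congr (\dim _).
by rewrite [RHS]capvC capvA (capv_idPl SB).
Qed.

(** Replacing [A] by its projection on [S] reduces to the case [S <= A], at the cost of a constant
    shift of the codimension. *)
Lemma sum_generators (R : pzRingType) A S (f : nat -> R) : A \in gens -> totally_singular S ->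
  (\dim S <= d)%N ->
  \sum_(B in gens | (S <= B)%VS) f (d - \dim (B :&: A))%N =
  \sum_(e < (d - \dim S).+1) (qbin q (d - \dim S) e * q ^ 'C(e, 2))%:R
     * f (e + (\dim S - \dim (S :&: A)))%N.
Proof.
move=> Ag Ss dS; have dSA := dimvS (capvSl S A).
have A'g := project_generator Ag Ss.
rewrite -(sum_generators_sub (fun e => f (e + (\dim S - \dim (S :&: A)))%N) A'g (addvSr _ _)).
apply: eq_bigr => B /andP[Bg SB]; congr f.
have := dim_cap_project A Bg Ss SB; have := dimvS (capvSl B (project A S)).
by have [_ ->] := generatorsP _ Bg; lia.
Qed.

End GeneratorCounts.

(** * Eigenvalues *)

(** For [S] of dimension [j], [s] is the codimension in [S] of its meet with a generator [B]. The
    first factor is the number of such meets times the absolute Moebius value; the second counts the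
    generators through [S] whose meet with [B] has codimension [2 * i]. *)
Definition eigenvalue_term (q d i j s : nat) : nat :=
  (qbin q j s * q ^ 'C(s, 2)) * (qbin q (d - j) (2 * i - s) * q ^ 'C(2 * i - s, 2)).

(* P_j of the opening comment. *)
Definition half_graph_eigenvalue (q d i j : nat) : int :=
  \sum_(s < (2 * i).+1) (-1) ^+ s * (eigenvalue_term q d i j s)%:Z.

Lemma bin2_mul2 n : (2 * 'C(n, 2) + n = n * n)%N.
Proof. by elim: n => [|n IHn] //; rewrite binS bin1; lia. Qed.

(** Only [s = 0] and [s = 1] contribute, [qbin q 1 s] being 0 beyond. The result is [k0 - k1]. *)
Lemma half_graph_eigenvalue1 q d i : (0 < i)%N ->
  half_graph_eigenvalue q d i 1 =
  (qbin q (d - 1) (2 * i) * q ^ 'C(2 * i, 2))%:Z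
   - (qbin q (d - 1) (2 * i - 1) * q ^ 'C(2 * i - 1, 2))%:Z.
Proof.
case: i => // i _; rewrite /half_graph_eigenvalue !big_ord_recl /= big1 ?addr0.
  by rewrite /eigenvalue_term qbinn0 qbinnn bin0n !mul1n subn0 expr0 expr1 mul1r mulN1r.
by move=> s _; rewrite /eigenvalue_term /= qbin_small ?mul0n ?mulr0.
Qed.

(* The exponent e t equals i * (i - 1) + (t - i) ^ 2. *)
Lemma eigenvalue_exponent_lt i j s : (1 < i)%N -> (1 < j)%N ->
  let e t := ('C(t, 2) + 'C(2 * i - t, 2))%N in
  (s <= 2 * i)%N -> (s <= j)%N -> s != minn i j -> (e (minn i j) < e s)%N.
Proof.
move=> i1 j1 e si sj ns.
have := bin2_mul2 s; have := bin2_mul2 (2 * i - s).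
have := bin2_mul2 (minn i j); have := bin2_mul2 (2 * i - minn i j).
rewrite /e; move: ns.
have [lij|lji] := leqP i j.
  have -> : (2 * i - i = i)%N by lia.
  move: ('C(_, _)) => c1; move: ('C(_, _)) => c2; move: ('C(_, _)) => c3.
  have [t et] : exists t, (s + t = 2 * i)%N by exists (2 * i - s)%N; lia.
  have -> : (2 * i - s = t)%N by lia.
  move=> ns h1 _ h3 h4; suff : (i * i + i * i < s * s + t * t)%N by lia.
  have [b [b0 [[es et']|[es et']]]] : 
    exists b, (0 < b)%N /\ ((i = s + b /\ t = i + b) \/ (s = i + b /\ i = t + b))%N.
    by have [?|?] := ltnP s i; [exists (i - s)%N | exists (s - i)%N]; lia.
    have bb : (0 < b * b)%N by rewrite muln_gt0 b0.
    by rewrite et' es; lia.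
  have bb : (0 < b * b)%N by rewrite muln_gt0 b0.
  by rewrite es et'; lia.
have [a ea] : exists a, (j = s + a)%N by exists (j - s)%N; lia.
have [t et] : exists t, (2 * i = j + t)%N by exists (2 * i - j)%N; lia.
have -> : (2 * i - j = t)%N by lia.
have -> : (2 * i - s = t + a)%N by lia.
move=> ns h1 h2 h3 h4.
suff : (j * j + t * t < s * s + (t + a) * (t + a))%N by lia.
(* Here [s < j < i], and the two sides differ by [2 * a * (t - s)]. *)
have st : (s * a < t * a)%N by rewrite ltn_mul2r; lia.
by rewrite ea; lia.
Qed.

(** The term [s0 = minn i j] of [P_j] alone has the least exponent [m]. As [s0] is at least 2, it
    does not occur in [P_1], so [q ^ m.+1] divides [P_1] but not [P_j]. *)
Lemma half_graph_eigenvalue_neq_val q d i j :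
  (1 < q)%N -> (1 < i <= d./2)%N -> (1 < j <= d./2)%N ->
  half_graph_eigenvalue q d i j != half_graph_eigenvalue q d i 1.
Proof.
move=> q1 /andP[i1 id] /andP[j1 jd]; apply/eqP => e.
pose ex t := ('C(t, 2) + 'C(2 * i - t, 2))%N.
pose s0 := minn i j; pose m := ex s0.
have termE k s : eigenvalue_term q d i k s =
    (q ^ ex s * (qbin q k s * qbin q (d - k) (2 * i - s)))%N.
  by rewrite /eigenvalue_term /ex expnD; ring.
(* The premise [s <= k -> s <= j] lets the claim serve for both [k = 1] and [k = j]. *)
have dvd_term k s : (s <= 2 * i)%N -> s != s0 -> (s <= k -> s <= j)%N ->
    ((q ^ m.+1)%:Z %| (-1) ^+ s * (eigenvalue_term q d i k s)%:Z)%Z.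
  move=> si ns skj; have [lks|lsk] := ltnP k s.
    by rewrite /eigenvalue_term qbin_small // mul0n mulr0 dvdz0.
  apply: dvdz_mull; rewrite termE dvdzE /= dvdn_mulr // dvdn_exp2l //.
  by apply: eigenvalue_exponent_lt => //; apply: skj.
have dvd1 : ((q ^ m.+1)%:Z %| half_graph_eigenvalue q d i 1)%Z.
  apply: rpred_sum => s _; have [s1|s1] := leqP s 1.
    by apply: dvd_term; have := ltn_ord s; rewrite /s0; lia.
  by rewrite /eigenvalue_term qbin_small // mul0n mulr0 rpred0.
have s0i : (s0 < (2 * i).+1)%N by rewrite /s0; lia.
have : ((q ^ m.+1)%:Z %| (-1) ^+ s0 * (eigenvalue_term q d i j s0)%:Z)%Z.
  move: dvd1; rewrite -e /half_graph_eigenvalue (bigD1 (Ordinal s0i)) //=.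
  rewrite rpredDr //; apply: rpred_sum => s ns.
  by apply: dvd_term => //; rewrite -ltnS.
rewrite termE dvdzE abszMsign /= expnSr dvdn_pmul2l ?expn_gt0 ?(ltnW q1) //.
(* The bounds on [i] and [j] give [2 * i - s0 <= d - j], so both Gaussian binomials are 1 modulo
   [q]. *)
rewrite /dvdn -modnMm !qbin_modq //; try by rewrite /s0; lia.
by rewrite !modn_small // mul1n modn_small.
Qed.

Lemma PoszX m n : (m ^ n)%:Z = m%:Z ^+ n.
Proof. by elim: n => [|n IHn] //; rewrite expnS exprS PoszM IHn. Qed.

Lemma qbin_one q n : (q%:Z - 1) * (qbin q n 1)%:Z = q%:Z ^+ n - 1.
Proof.
elim: n => [|n IHn]; first by rewrite qbin_small // mulr0 subrr.
rewrite qbinS qbinn0 muln1 subn0 PoszD mulrDr IHn exprS PoszX; ring.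
Qed.

(** The extra factor [q] turns the usual [q ^ (n - 1) - 1] into [q ^ n - q], which avoids a
    truncated exponent at [n = 0]. *)
Lemma qbin_two q n :
  (q%:Z - 1) * (q%:Z ^+ 2 - 1) * (q%:Z * (qbin q n 2)%:Z) = (q%:Z ^+ n - 1) * (q%:Z ^+ n - q%:Z).
Proof.
elim: n => [|n IHn]; first by rewrite qbin_small // !mulr0 subrr mul0r.
have : q%:Z * (qbin q n.+1 2)%:Z = q%:Z * (qbin q n 2)%:Z + q%:Z ^+ n * (qbin q n 1)%:Z.
  case: n {IHn} => [|n]; first by rewrite !qbin_small // !mulr0 addr0.
  by rewrite [in LHS]qbinS subSS subn0 PoszD PoszM PoszX exprS; ring.
move=> ->; rewrite mulrDr IHn.
have := qbin_one q n; rewrite (exprS _ n); move: (_ ^+ n) => a h.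
have -> : (q%:Z - 1) * (q%:Z ^+ 2 - 1) * (a * (qbin q n 1)%:Z)
  = (q%:Z ^+ 2 - 1) * a * ((q%:Z - 1) * (qbin q n 1)%:Z) by ring.
by rewrite h; ring.
Qed.

(** Put [a = q ^ j] and [b = q ^ (d - j)]. The terms linear in [a + b] cancel and [a * b = q ^ d],
    so [j] enters only through [(a + b) ^ 2]. *)
Lemma half_graph_eigenvalue_one q d j : (j <= d)%N ->
  (q%:Z - 1) * (q%:Z ^+ 2 - 1) * half_graph_eigenvalue q d 1 j =
  (q%:Z ^+ j + q%:Z ^+ (d - j)) ^+ 2 - (q%:Z + 1) * (q%:Z ^+ d + 1) + 2 * (q%:Z - q%:Z ^+ d).
Proof.
move=> jd.
have -> : half_graph_eigenvalue q d 1 j = q%:Z * (qbin q (d - j) 2)%:Z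
    - (qbin q j 1)%:Z * (qbin q (d - j) 1)%:Z + q%:Z * (qbin q j 2)%:Z.
  rewrite /half_graph_eigenvalue !big_ord_recl big_ord0 /= /eigenvalue_term /bump /=.
  rewrite !addn0 muln1 subnn subn0 (_ : 2 - 1 = 1)%N // !qbinn0 bin0n (_ : 'C(2, 2) = 1)%N //.
  rewrite (_ : 'C(1, 2) = 0)%N // expr0 expn0 expn1 !mul1n !muln1 (mulnC _ q) !PoszM; ring.
have -> : q%:Z ^+ d = q%:Z ^+ j * q%:Z ^+ (d - j) by rewrite -exprD subnKC.
have := qbin_two q j; have := qbin_two q (d - j); have := qbin_one q j; have := qbin_one q (d - j).
move: (_ ^+ j) (_ ^+ (d - j)) => a b h1 h2 h3 h4.
rewrite mulrDr mulrBr h3 h4.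
have -> : (q%:Z - 1) * (q%:Z ^+ 2 - 1) * ((qbin q j 1)%:Z * (qbin q (d - j) 1)%:Z) =
  (q%:Z + 1) * (((q%:Z - 1) * (qbin q j 1)%:Z) * ((q%:Z - 1) * (qbin q (d - j) 1)%:Z)) by ring.
rewrite h1 h2; ring.
Qed.

Lemma half_graph_eigenvalue_neq q d i j : (1 < q)%N -> (1 <= i <= d./2)%N -> (1 < j <= d./2)%N ->
  half_graph_eigenvalue q d i j != half_graph_eigenvalue q d i 1.
Proof.
move=> q1 /andP[i1 id] jd; move: i1; rewrite leq_eqVlt => /orP[/eqP <-|i1]; last first.
  by apply: half_graph_eigenvalue_neq_val; rewrite ?i1.
apply/eqP => e; have /andP[j1 jd2] := jd.
have := half_graph_eigenvalue_one q (_ : j <= d)%N; rewrite e half_graph_eigenvalue_one; try lia.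
move=> /(_ _)/addIr/addIr; rewrite expr1 => h.
have ab : q%:Z ^+ j * q%:Z ^+ (d - j) = q%:Z * q%:Z ^+ (d - 1).
  by rewrite -exprD -exprS; congr (_ ^+ _); lia.
have qX k : 0 < q%:Z ^+ k by rewrite exprn_gt0 // ltz_nat ltnW.
have {}h : q%:Z ^+ j + q%:Z ^+ (d - j) = q%:Z + q%:Z ^+ (d - 1).
  apply/eqP; rewrite -(@eqrXn2 _ 2) //; first by rewrite h //; lia.
  - by rewrite addr_ge0 // ltW.
  - by rewrite addr_ge0 // ltW.
(* The pair [q ^ j], [q ^ (d - j)] has the sum and the product of [q], [q ^ (d - 1)], so [j] is 1 or
   [d - 1], outside the range. *)
have : (q%:Z ^+ j - q%:Z) * (q%:Z ^+ j - q%:Z ^+ (d - 1)) = 0.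
  transitivity (q%:Z ^+ j * q%:Z ^+ j - q%:Z ^+ j * (q%:Z + q%:Z ^+ (d - 1))
    + q%:Z * q%:Z ^+ (d - 1)).
    by ring.
  by rewrite -h -ab; ring.
move/eqP; rewrite mulf_eq0 !subr_eq0 -{2}(expr1 q%:Z) -!PoszX !eqz_nat !eqn_exp2l //.
by lia.
Qed.

(** * Functions on a class of generators *)

Section GeneratorClass.
Variables (F : finFieldType) (d : nat).
Local Notation V := 'rV[F]_(d + d).
Local Notation q := #|F|.
Local Notation gens := (generators F d).
Variable G : {set {vspace V}}.
Hypothesis G_class : G \in generator_classes F d.
Implicit Types (x : V) (U S T A B C : {vspace V}).

Lemma card_field_gt1 : (1 < q)%N.
Proof. exact: finNzRing_gt1. Qed.

Lemma class_sub A : A \in G -> A \in gens.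
Proof.
by have /imsetP[X _ ->] := G_class; rewrite inE => /andP[].
Qed.

Lemma class_neq0 : exists A, A \in G.
Proof.
have /imsetP[X Xg ->] := G_class; exists X; rewrite inE Xg /=.
by have [_ dX] := generatorsP _ Xg; rewrite /same_class capvv dX.
Qed.

(** [odd_dim_cap], applied to [A], [B] and a representative of the class, turns membership into a
    parity condition relative to any member. *)
Lemma class_mem A B : A \in G -> B \in gens -> (B \in G) = ~~ odd (d - \dim (B :&: A)).
Proof.
have /imsetP[X Xg ->] := G_class; rewrite inE => /andP[Ag].
rewrite /same_class !modn2 => /eqP XA Bg.
rewrite inE Bg /= /same_class !modn2.
have [_ dB] := generatorsP _ Bg; have := dimvS (capvSl B A); rewrite dB => le.
have := odd_dim_cap Xg Ag Bg; rewrite !oddD oddB // (capvC A B).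
by move: XA; do 4!case: (odd _).
Qed.

Lemma points_sub A p : A \in gens ->
  (p \in points F d) && (p <= A)%VS = (p <= A)%VS && (\dim p == 1%N).
Proof.
move=> /generatorsP[As _]; rewrite inE; case pA : (p <= A)%VS; rewrite /= ?andbF // andbT.
by rewrite (totally_singularS pA As).
Qed.

Lemma sum_points_sub (R : pzRingType) A : A \in gens -> (0 < d)%N ->
  \sum_(p in points F d | (p <= A)%VS) (1 : R) = (qbin q d (d - 1))%:R.
Proof.
move=> Ag d0; have [_ dA] := generatorsP _ Ag.
have <- : #|codim_subspaces 0%VS A (d - 1)| = qbin q d (d - 1).
  by apply: card_codim_subspaces; rewrite ?sub0v // dimv0 dA.
rewrite sumr_const; congr (_%:R); apply: eq_card => p; rewrite !inE unfold_in.
rewrite points_sub // sub0v /= dA; congr andb; lia.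
Qed.

Lemma card_vspace_rV U : #|[pred x : V | x \in U]| = (q ^ \dim U)%N.
Proof. exact: card_vspace. Qed.

(** Twice the indicator of [G] is [1 + (-1) ^ codim], where [codim] is the codimension of the meet
    with [A]. Of the two resulting sums over all generators through [p], the alternating one
    vanishes. *)
Lemma sum_class_point A p (R : numDomainType) : (1 < d)%N -> A \in G -> p \in points F d ->
  \sum_(B in G | (p <= B)%VS) (1 : R) = \prod_(1 <= k < d.-1) (q%:R ^+ k + 1).
Proof.
move=> d1 AG; rewrite inE => /andP[ps /eqP dp]; have Ag := class_sub AG.
have := @sum_generators _ _ R A p (fun e => 1 + (-1) ^+ e) Ag ps.
rewrite dp => /(_ (ltnW d1)); set s := (1 - _)%N => h.
have two0 : 2 != 0 :> R by rewrite pnatr_eq0.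
apply: (mulfI two0); rewrite mulr_sumr.
transitivity (\sum_(B in gens | (p <= B)%VS) (1 + (-1) ^+ (d - \dim (B :&: A)) : R)).
  rewrite [RHS]big_mkcond [LHS]big_mkcond /=; apply: eq_bigr => B _.
  have [Bg|nBg] := boolP (B \in gens); last first.
    by rewrite (_ : B \in G = false) //; apply: contraNF nBg; apply: class_sub.
  rewrite (class_mem AG Bg); case: (p <= B)%VS; rewrite ?andbF // andbT /= -signr_odd.
  by case: (odd _); rewrite /= ?subrr // expr0 mulr1.
have [n en] : exists n, (d - 1 = n.+1)%N by exists (d - 2)%N; lia.
have {}en' : d.-1 = n.+1 by lia.
rewrite h en en' (big_add1 _ _ 0) /= big_mkord.
have e1 := q_binomial_theorem q n.+1 (1 : R).
have e2 : \sum_(e < n.+2) (qbin q n.+1 e * q ^ 'C(e, 2))%:R * (-1) ^+ e = 0 :> R.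
  by rewrite q_binomial_theorem big_ord_recl expr0 mul1r subrr mul0r.
transitivity (\sum_(e < n.+2) (qbin q n.+1 e * q ^ 'C(e, 2))%:R * 1 ^+ e
  + (-1) ^+ s * \sum_(e < n.+2) (qbin q n.+1 e * q ^ 'C(e, 2))%:R * (-1) ^+ e : R).
  rewrite mulr_sumr -big_split /=; apply: eq_bigr => e _.
  by rewrite expr1n exprD; ring.
(* The factor [k = 0] is [1 + 1], matching the 2 on the other side. *)
rewrite e1 e2 mulr0 addr0 big_ord_recl expr0 mul1r; congr (_ * _).
by apply: eq_bigr => k _; rewrite mulr1 addrC.
Qed.

Section Functions.
Variables (R : numDomainType) (v : {vspace V} -> R).

Definition sum_through S : R := \sum_(B in G | (S <= B)%VS) v B.

(* Moebius inversion in the lattice of subspaces of [S]. *)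
Lemma sum_meeting S T s :
  (forall U, (U <= S)%VS -> U != S -> sum_through U = 0) ->
  (T <= S)%VS -> (\dim T + s)%N = \dim S ->
  \sum_(B in G | (S :&: B)%VS == T) v B = (-1) ^+ s * (q ^ 'C(s, 2))%:R * sum_through S.
Proof.
move=> v0; have [n] := ubnP s; elim: n s T => // n IHn s T lsn TS dT.
have [s0|s_gt0] := posnP s.
  have -> : T = S by apply/eqP; rewrite eqEdim TS; lia.
  rewrite s0 bin0n expn0 expr0 !mul1r; apply: eq_bigl => B; congr andb.
  by apply/eqP/idP => [/capv_idPl|/capv_idPl].
(* [f] and the claimed value [g] both sum to 0 over the interval from [T] to [S] and agree above [T]
   by induction, hence agree at [T]. *)
pose f U := \sum_(B in G | (S :&: B)%VS == U) v B.
pose g e : R := (-1) ^+ e * (q ^ 'C(e, 2))%:R * sum_through S.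
have sumf : \sum_(U | (T <= U)%VS && (U <= S)%VS) f U = 0.
  transitivity (sum_through T); last first.
    by apply: v0 => //; apply: contraTneq s_gt0 => eT; rewrite -leqNgt; move: dT; rewrite eT; lia.
  rewrite /sum_through [RHS](partition_big (fun B => (S :&: B)%VS)
    (fun U => (T <= U)%VS && (U <= S)%VS)) /=.
    apply: eq_bigr => U /andP[TU US]; apply: eq_bigl => B.
    case: (B \in G) => //=; apply/esym/andb_idl => /eqP eU.
    by apply: subv_trans TU _; rewrite -eU capvSr.
  by move=> B /andP[_ TB]; rewrite subv_cap TS TB capvSl.
have sumg : \sum_(U | (T <= U)%VS && (U <= S)%VS) g (\dim S - \dim U)%N = 0.
  rewrite (sum_subspaces g TS).
  transitivity ((\sum_(e < (\dim S - \dim T).+1)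
    (qbin q (\dim S - \dim T) e * q ^ 'C(e, 2))%:R * (-1) ^+ e : R) * sum_through S).
    by rewrite mulr_suml; apply: eq_bigr => e _; rewrite /g natrM; ring.
  rewrite q_binomial_theorem (_ : \dim S - \dim T = s.-1.+1)%N; last lia.
  by rewrite big_ord_recl expr0 mul1r subrr !mul0r.
have TT : (T <= T)%VS && (T <= S)%VS by rewrite subvv.
have := etrans sumf (esym sumg); rewrite (bigD1 T) //= [RHS](bigD1 T) //=.
have -> : \sum_(U | (T <= U)%VS && (U <= S)%VS && (U != T)) f U =
          \sum_(U | (T <= U)%VS && (U <= S)%VS && (U != T)) g (\dim S - \dim U)%N.
  apply: eq_bigr => U /andP[/andP[TU US] nU].
  rewrite /f (IHn (\dim S - \dim U)%N) //; last by rewrite subnKC ?dimvS.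
  have /ltn_leqif := dimv_leqif_eq TU; rewrite eq_sym nU.
  by have := dimvS US; lia.
by move=> /addIr; rewrite /f /g => ->; rewrite (_ : \dim S - \dim T = s)%N //; lia.
Qed.

(* Expand q ^ \dim (B :&: A) as the number of x in A lying in B, and absorb x
   into U. *)
Lemma sum_through_poly n A (c : nat -> R) m U :
  A \in gens -> (forall S, totally_singular S -> (\dim S <= n)%N -> sum_through S = 0) ->
  (U <= A)%VS -> (\dim U + m <= n)%N ->
  \sum_(B in G | (U <= B)%VS) v B * \prod_(k < m) ((q ^ \dim (B :&: A))%:R - c k) = 0.
Proof.
move=> Ag v0; have [As _] := generatorsP _ Ag; elim: m U => [|m IHm] U UA dU.
  under eq_bigr do rewrite big_ord0 mulr1.
  by apply: v0; [apply: totally_singularS As | rewrite addn0 in dU].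
under eq_bigr do rewrite big_ord_recr /= mulrBr mulrBr.
rewrite sumrB; under [X in _ - X]eq_bigr do rewrite mulrA.
rewrite -mulr_suml IHm //; last lia.
rewrite mul0r subr0.
transitivity (\sum_(x in A) \sum_(B in G | (U + <[x]> <= B)%VS)
   v B * \prod_(k < m) ((q ^ \dim (B :&: A))%:R - c k)); last first.
  apply: big1 => x xA; apply: IHm; first by rewrite subv_add_line UA.
  have := dimv_add_leqif U <[x]>; rewrite dim_vline => -[le _].
  by have := leq_b1 (x != 0); lia.
rewrite (exchange_big_dep (fun B => (B \in G) && (U <= B)%VS)) /=; last first.
  by move=> x B _; rewrite subv_add_line => /and3P[-> ->].
apply: eq_bigr => B /andP[BG UB].
rewrite mulrA -card_vspace_rV mulr_natr -sumr_const; apply: eq_bigl => x.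
by rewrite subv_add_line BG UB /= inE memv_cap andbC.
Qed.

(** Double count incident points and generators: every generator has the same number of points,
    which is nonzero because it is 1 modulo [q]. *)
Lemma sum_through_zero : (0 < d)%N ->
  (forall p, p \in points F d -> sum_through p = 0) -> \sum_(B in G) v B = 0.
Proof.
move=> d0 v0.
have N0 : (qbin q d (d - 1))%:R != 0 :> R.
  rewrite pnatr_eq0; apply/eqP => e.
  by have := qbin_modq card_field_gt1 (leq_subr 1 d); rewrite e mod0n modn_small ?card_field_gt1.
apply: (mulfI N0); rewrite mulr0 mulr_sumr.
transitivity (\sum_(p in points F d) sum_through p); last by rewrite big1.
rewrite (exchange_big_dep [in G]) /= => [|p B _ /andP[]//].
apply: eq_bigr => B BG; rewrite -(sum_points_sub R (class_sub BG) d0) mulr_suml.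
by apply: eq_big => [p|p _]; rewrite ?BG ?mul1r.
Qed.

End Functions.

Variable i : nat.
Hypothesis i_range : (1 <= i <= d./2)%N.

(** Take the indicator of codimension [2 * i] in [sum_generators]; this codimension is even, so the
    generators counted lie in [G]. The test [s <= 2 * i] guards the truncated [2 * i - s]. *)
Lemma card_related A S : A \in G -> totally_singular S -> (\dim S <= d)%N ->
  let s := (\dim S - \dim (S :&: A))%N in
  \sum_(B in G | (S <= B)%VS && (\dim (A :&: B) == d - 2 * i)%N) 1%N =
  if (s <= 2 * i)%N then (qbin q (d - \dim S) (2 * i - s) * q ^ 'C(2 * i - s, 2))%N else 0%N.
Proof.
move=> AG Ss dS s; have Ag := class_sub AG.
have := @sum_generators _ _ int A S (fun e => (e == 2 * i)%N%:R) Ag Ss dS.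
rewrite -/s => h; apply/eqP; rewrite -eqz_nat; apply/eqP.
transitivity (\sum_(B in gens | (S <= B)%VS) ((d - \dim (B :&: A))%N == (2 * i)%N)%:R : int).
  rewrite -natz natr_sum [RHS]big_mkcond [LHS]big_mkcond /=; apply: eq_bigr => B _.
  have [Bg|nBg] := boolP (B \in gens); last first.
    by rewrite (_ : B \in G = false) //; apply: contraNF nBg; apply: class_sub.
  have [_ dB] := generatorsP _ Bg; have := dimvS (capvSl B A); rewrite dB => le.
  rewrite (class_mem AG Bg) (capvC A B); case SB : (S <= B)%VS; rewrite /= ?andbF //.
  have -> : (\dim (B :&: A) == d - 2 * i)%N = (d - \dim (B :&: A) == 2 * i)%N by lia.
  by have [->|] := eqVneq; rewrite ?andbF // mul2n odd_double.
rewrite h; case: leqP => [le|lt]; last first.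
  by rewrite big1 // => e _; rewrite (_ : _ == _ = false) ?mulr0 //; lia.
have [le2|lt2] := leqP (2 * i - s) (d - \dim S).
  have lt3 : (2 * i - s < (d - \dim S).+1)%N by [].
  rewrite (bigD1 (Ordinal lt3)) //= subnK // eqxx mulr1 big1 ?addr0 ?natz // => e ne.
  rewrite (_ : _ == _ = false) ?mulr0 //; apply: contraNF ne => /eqP ee.
  by apply/eqP/val_inj => /=; lia.
rewrite qbin_small // mul0n big1 // => e _; rewrite (_ : _ == _ = false) ?mulr0 //.
by have := ltn_ord e; lia.
Qed.

(** * Eigenvectors of the relation of codimension [2 * i] *)

Section Eigenvector.
Variables (R : numDomainType) (v : {vspace V} -> R).

(** Sum the eigenvalue equation over the generators through [S]. After exchanging sums, the
    coefficient of [v B] depends only on [S :&: B], and [sum_meeting] evaluates each group. *)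
Lemma sum_through_eigen lambda S :
  totally_singular S -> (\dim S <= d)%N ->
  (forall A, A \in G -> \sum_(B in G | (\dim (A :&: B) == d - 2 * i)%N) v B = lambda * v A) ->
  (forall U, (U <= S)%VS -> U != S -> sum_through v U = 0) ->
  lambda * sum_through v S = (half_graph_eigenvalue q d i (\dim S))%:~R * sum_through v S.
Proof.
move=> Ss dS eig v0.
rewrite /sum_through mulr_sumr.
pose h s := if (s <= 2 * i)%N
  then (qbin q (d - \dim S) (2 * i - s) * q ^ 'C(2 * i - s, 2))%N else 0%N.
transitivity (\sum_(B in G) v B * (h (\dim S - \dim (S :&: B))%N)%:R).
  under eq_bigr => A /andP[AG _] do rewrite -eig //.
  rewrite (exchange_big_dep [in G]) /= => [|A B _ /andP[]//].
  apply: eq_bigr => B BG; rewrite /h -(card_related BG Ss dS) natr_sum mulr_sumr.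
  rewrite [LHS]big_mkcond [RHS]big_mkcond /=; apply: eq_bigr => A _.
  by rewrite mulr1 BG /= capvC andbA; case: (_ && _ && _).
rewrite (partition_big (fun B => (S :&: B)%VS)
  (fun T => (0 <= T)%VS && (T <= S)%VS)) /=; last first.
  by move=> B _; rewrite sub0v capvSl.
transitivity (\sum_(T | (0 <= T)%VS && (T <= S)%VS)
  ((-1) ^+ (\dim S - \dim T) * (q ^ 'C(\dim S - \dim T, 2))%:R
     * (h (\dim S - \dim T)%N)%:R * sum_through v S)).
  apply: eq_bigr => T /andP[_ TS].
  rewrite [RHS]mulrAC -(sum_meeting v0 TS) ?subnKC ?dimvS // mulr_suml.
  by apply: eq_bigr => B /andP[_ /eqP ->].
rewrite -mulr_suml; congr (_ * _).
rewrite (sum_subspaces (fun s => (-1) ^+ s * (q ^ 'C(s, 2))%:R * (h s)%:R) (sub0v S)) dimv0 subn0.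
rewrite /half_graph_eigenvalue rmorph_sum /=.
(* One sum stops at [\dim S], the other at [2 * i]; over a common range, the terms present on one
   side only are 0. *)
pose N := (\dim S + 2 * i)%N.
rewrite (big_ord_widen N.+1
    (fun e => (qbin q (\dim S) e)%:R * ((-1) ^+ e * (q ^ 'C(e, 2))%:R * (h e)%:R)));
  last by rewrite ltnS leq_addr.
rewrite (big_ord_widen N.+1 (fun e => ((-1) ^+ e * (eigenvalue_term q d i (\dim S) e)%:Z)%:~R));
  last by rewrite ltnS leq_addl.
rewrite big_mkcond [RHS]big_mkcond /=; apply: eq_bigr => e _.
rewrite /h /eigenvalue_term !ltnS; case: (leqP e (2 * i)) => _; last by rewrite !mulr0 if_same.
case: leqP => [_|lt]; last by rewrite qbin_small // !mul0n mulr0.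
by rewrite intrM intr_sign -pmulrn !natrM; ring.
Qed.

Lemma eigenvector_trivial : ~~ odd d ->
  (forall p, p \in points F d -> sum_through v p = 0) ->
  (forall A, A \in G -> \sum_(B in G | (\dim (A :&: B) == d - 2 * i)%N) v B
     = (half_graph_eigenvalue q d i 1)%:~R * v A) ->
  forall A, A \in G -> v A = 0.
Proof.
move=> d_even v0 eig A AG; have Ag := class_sub AG; have [_ dA] := generatorsP _ Ag.
have d0 : (0 < d)%N by lia.
(* Dimensions 0 and 1 follow from the hypothesis on points; from dimension 2 on, a nonzero sum would
   force [P_j = P_1] for [j = \dim S]. *)
have vn n : (n <= d./2)%N -> forall S, totally_singular S -> (\dim S <= n)%N -> sum_through v S = 0.
  elim: n => [|n IHn] len S Ss dS.
    have /eqP -> : S == 0%VS by rewrite -dimv_eq0; lia.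
    rewrite -(sum_through_zero d0 v0) /sum_through; apply: eq_bigl => B.
    by rewrite sub0v andbT.
  have [dSn|dSn] := leqP (\dim S) n; first by apply: IHn => //; lia.
  have {dSn}dSn : \dim S = n.+1 by lia.
  case: n IHn len dS dSn => [|n] IHn len dS dSn.
    by apply: v0; rewrite inE Ss dSn /=.
  have vU U : (U <= S)%VS -> U != S -> sum_through v U = 0.
    move=> US nU; apply: IHn; [lia | exact: totally_singularS Ss |].
    by have /ltn_leqif := dimv_leqif_eq US; rewrite nU; lia.
  have := sum_through_eigen Ss _ eig vU; rewrite dSn => /(_ _)/eqP.
  rewrite -subr_eq0 -mulrBl mulf_eq0 subr_eq0 eqr_int eq_sym.
  rewrite (negPf (half_graph_eigenvalue_neq card_field_gt1 i_range _)) //=.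
  by move=> h; apply/eqP/h; lia.
(* The nodes [q ^ (2 * k)], [k < d./2], include every value of [q ^ \dim (B :&: A)] for [B != A] in
   [G], these dimensions being even and below [d]. Only the term of [A] survives, with a nonzero
   coefficient. *)
have := sum_through_poly (fun k => (q ^ (2 * k))%:R) (m := d./2) Ag (vn _ (leqnn _)) (sub0v A).
rewrite dimv0 => /(_ (leqnn _)); rewrite (bigD1 A) /=; last by rewrite AG sub0v.
rewrite [X in _ + X]big1 ?addr0 => [/eqP|B /andP[/andP[BG _] BA]].
  rewrite mulf_eq0 => /orP[/eqP //|]; rewrite capvv dA prodf_seq_eq0 => /hasP[k _].
  rewrite subr_eq0 eqr_nat eqn_exp2l ?card_field_gt1 //.
  by have := ltn_ord k; lia.
have Bg := class_sub BG; have [_ dB] := generatorsP _ Bg.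
have := class_mem AG Bg; rewrite BG => /esym; have := dimvS (capvSl B A); rewrite dB => le even_dBA.
have lt : (\dim (B :&: A) < d)%N.
  rewrite ltn_neqAle le andbT; apply: contra BA => /eqP eBA.
  apply/eqP; apply: generators_eq => //; apply/capv_idPl/eqP.
  by rewrite eqEdim capvSl dB eBA /=.
have kd : ((\dim (B :&: A))./2 < d./2)%N by lia.
rewrite (bigD1 (Ordinal kd)) //= (_ : 2 * _ = \dim (B :&: A))%N; last lia.
by rewrite subrr mul0r mulr0.
Qed.

End Eigenvector.

Section PointSums.
Variable R : realType.
Local Notation k0 := ((qbin q (d - 1) (2 * i) * q ^ 'C(2 * i, 2))%:R : R).
Local Notation k1 := ((qbin q (d - 1) (2 * i - 1) * q ^ 'C(2 * i - 1, 2))%:R : R).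

(** This is [A_i N^T = (k0 - k1) N^T + k1 J] applied to a weight [w] on the points; [card_related]
    gives [k0] and [k1] as the cases [s = 0] and [s = 1] for a point. *)
Lemma sum_related_points (w : {vspace V} -> R) A : A \in G ->
  \sum_(B in G | (\dim (A :&: B) == d - 2 * i)%N) \sum_(p in points F d | (p <= B)%VS) w p =
  k1 * \sum_(p in points F d) w p + (k0 - k1) * \sum_(p in points F d | (p <= A)%VS) w p.
Proof.
move=> AG; rewrite (exchange_big_dep [in points F d]) /= => [|B p _ /andP[]//].
rewrite !mulr_sumr [X in _ + X]big_mkcondr -big_split /=; apply: eq_bigr => p pP.
have /andP[ps /eqP dp] : totally_singular p && (\dim p == 1%N) by move: pP; rewrite inE.
transitivity ((\sum_(B in G | (p <= B)%VS && (\dim (A :&: B) == d - 2 * i)%N) 1)%N%:R * w p).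
  rewrite natr_sum mulr_suml; apply: eq_big => [B|B _]; last by rewrite mul1r.
  by rewrite pP -andbA; congr andb; apply: andbC.
have := card_related AG ps; rewrite dp => ->; last lia.
case pA : (p <= A)%VS.
  rewrite (capv_idPl pA) dp subnn leq0n subn0; ring.
have -> : \dim (p :&: A) = 0%N.
  apply/eqP; rewrite -leqn0 -ltnS -[X in (_ < X)%N]dp.
  have /ltn_leqif -> := dimv_leqif_eq (capvSl p A).
  by apply: contraFN pA => /eqP /capv_idPl.
rewrite subn0 (_ : 1 <= 2 * i)%N; [ring | lia].
Qed.

End PointSums.
End GeneratorClass.

(** * Cameron-Liebler sets *)

(** The diagonal entries of [X^T *m X] are the squared norms of the columns. *)
Lemma gram_eq0 (R : realFieldType) m n (X : 'M[R]_(m, n)) : X^T *m X = 0 -> X = 0.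
Proof.
move=> XX; apply/matrixP => k j; have := congr1 (fun Y : 'M_n => Y j j) XX.
rewrite !mxE => /eqP; rewrite psumr_eq0 => [/allP/(_ k)|l _].
  by rewrite mem_index_enum mxE mulf_eq0 orbb => /(_ isT)/eqP.
by rewrite mxE -expr2 sqr_ge0.
Qed.

(** The normal equations [M *m M^T *m w = M *m x] are solvable, since by [gram_eq0] whatever
    [M *m M^T] kills is already killed by [M^T]. *)
Lemma row_space_projection (R : realFieldType) m n (M : 'M[R]_(m, n)) (x : 'cV_n) :
  exists w : 'cV_m, M *m (x - M^T *m w) = 0.
Proof.
have /submxP[w ew] : (x^T *m M^T <= M *m M^T)%MS.
  rewrite submxE -mulmxA; set N := cokermx _.
  suff -> : M^T *m N = 0 by rewrite mulmx0.
  by apply: gram_eq0; rewrite trmx_mul trmxK mulmxA -(mulmxA _ M) -mulmxA mulmx_coker mulmx0.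
exists w^T; apply/eqP; rewrite mulmxBr subr_eq0 -(inj_eq trmx_inj) !trmx_mul !trmxK ew.
by rewrite mulmxA.
Qed.

Section Main.
Variables (R : realType) (F : finFieldType) (d : nat) (G : {set {vspace 'rV[F]_(d + d)}}).
Local Notation V := 'rV[F]_(d + d).
Local Notation q := #|F|.
Implicit Types (A B p : {vspace V}) (L : {set {vspace V}}).

Lemma incidence_mx_mulE (w : {vspace V} -> R) b :
  ((incidence_mx R G)^T *m (\col_a w (enum_val a))) b 0 =
  \sum_(p in points F d | (p <= enum_val b)%VS) w p.
Proof.
rewrite mxE [RHS]big_mkcondr [RHS]big_enum_val; apply: eq_bigr => a _.
by rewrite !mxE; case: ifP; rewrite ?mul1r ?mul0r.
Qed.

(** Only [a' = a] contributes. In this form a column extends to a function on all subspaces, zero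
    off the points, without a default index. *)
Lemma col_fibersE (w : 'cV[R]_#|points F d|) :
  w = \col_a (\sum_(a' | enum_val a' == enum_val a) w a' 0).
Proof.
apply/matrixP => a j; rewrite ord1 mxE (big_pred1 a) // => a'.
by rewrite (inj_eq enum_val_inj).
Qed.

Lemma cameron_lieblerP L : L \subset G ->
  cameron_liebler R G L <->
  exists w : {vspace V} -> R,
    forall B, B \in G -> (B \in L)%:R = \sum_(p in points F d | (p <= B)%VS) w p.
Proof.
move=> LG; split=> [[_ [w ew]]|[w ew]].
  exists (fun p => \sum_(a | enum_val a == p) w a 0) => B BG.
  have := congr1 (fun X : 'cV_ _ => X (enum_rank_in BG B) 0) ew.
  rewrite mxE enum_rankK_in // {1}(col_fibersE w)
    (incidence_mx_mulE (fun p => \sum_(a | enum_val a == p) w a 0)).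
  by rewrite enum_rankK_in.
split=> //; exists (\col_a w (enum_val a)); apply/matrixP => b j.
by rewrite ord1 incidence_mx_mulE mxE ew // enum_valP.
Qed.

Lemma point_decomposition (f : {vspace V} -> R) : exists w : {vspace V} -> R,
  forall p, p \in points F d ->
  \sum_(B in G | (p <= B)%VS) (f B - \sum_(p' in points F d | (p' <= B)%VS) w p') = 0.
Proof.
have [w ew] := row_space_projection (incidence_mx R G) (\col_b f (enum_val b)).
exists (fun p => \sum_(a | enum_val a == p) w a 0) => p pP.
have := congr1 (fun X : 'cV_ _ => X (enum_rank_in pP p) 0) ew.
rewrite [in LHS](col_fibersE w) mxE [RHS]mxE => e; rewrite -[RHS]e.
rewrite big_mkcondr [LHS]big_enum_val; apply: eq_bigr => b _.
rewrite mxE enum_rankK_in // 2!mxE (mxE _ _ b) -incidence_mx_mulE.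
by case: ifP; rewrite ?mul1r ?mul0r // !mxE.
Qed.

Lemma sum_indicator L (P : pred {vspace V}) : L \subset G ->
  \sum_(B in G | P B) (B \in L)%:R = #|[set B in L | P B]|%:R :> R.
Proof.
move=> /subsetP LG; rewrite -sum1_card natr_sum big_mkcond [RHS]big_mkcond /=.
apply: eq_bigr => B _; rewrite inE; have [/LG ->|] := boolP (B \in L); first by [].
by rewrite if_same.
Qed.

Lemma sum_class_points (w : {vspace V} -> R) A :
  G \in generator_classes F d -> (1 < d)%N -> A \in G ->
  \sum_(B in G) \sum_(p in points F d | (p <= B)%VS) w p =
  (\sum_(p in points F d) w p) * \prod_(1 <= k < d.-1) (q%:R ^+ k + 1).
Proof.
move=> G_class d1 AG; rewrite (exchange_big_dep [in points F d]) /= => [|B p _ /andP[]//].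
rewrite mulr_suml; apply: eq_bigr => p pP.
rewrite -(sum_class_point G_class R d1 AG pP) mulr_sumr; apply: eq_big => [B|B _].
  by rewrite pP.
by rewrite mulr1.
Qed.

End Main.

(** Brings both cases to [k1 * x + (k0 - k1) * b], the shape in which [sum_related_points] delivers
    the count, using ['C(2 * i - 1, 2) = (2 * i - 1) * (i - 1)]. *)
Lemma intersection_numberE (R : realType) q d i (x : R) (b : bool) : (1 < q)%N -> (0 < i)%N ->
  (if b then
     ((x - 1) * gauss_binom R q (d - 1) (2 * i - 1)
       + q%:R ^+ (2 * i - 1) * gauss_binom R q (d - 1) (2 * i))
     * q%:R ^+ ((2 * i - 1) * (i - 1))
   else
     x * gauss_binom R q (d - 1) (2 * i - 1) * q%:R ^+ ((2 * i - 1) * (i - 1))) =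
  (qbin q (d - 1) (2 * i - 1) * q ^ 'C(2 * i - 1, 2))%:R * x +
  ((qbin q (d - 1) (2 * i) * q ^ 'C(2 * i, 2))%:R
    - (qbin q (d - 1) (2 * i - 1) * q ^ 'C(2 * i - 1, 2))%:R) * b%:R.
Proof.
case: i => // i q1 _; rewrite !gauss_binomE //.
have -> : 'C(2 * i.+1, 2) = (2 * i.+1 - 1 + (2 * i.+1 - 1) * (i.+1 - 1))%N.
  by have := bin2_mul2 (2 * i.+1); lia.
have -> : 'C(2 * i.+1 - 1, 2) = ((2 * i.+1 - 1) * (i.+1 - 1))%N.
  by have := bin2_mul2 (2 * i.+1 - 1); lia.
move: (2 * i.+1)%N (2 * i.+1 - 1)%N ((2 * i.+1 - 1) * _)%N => a' a c.
by rewrite !natrM !natrX exprD; case: b => /=; ring.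
Qed.

Theorem theorem4p2 (R : realType) (F : finFieldType) (d i : nat)
    (G L : {set {vspace 'rV[F]_(d + d)}})
    (d_even : ~~ odd d)
    (G_class : G \in generator_classes F d)
    (L_sub_G : L \subset G)
    (i_range : (1 <= i <= d./2)%N) :
  let q := #|F| in
  let x : R := parameter R L in
  cameron_liebler R G L <->
  (forall pi : {vspace 'rV[F]_(d + d)}, pi \in G ->
     #|[set W in L | \dim (pi :&: W) == (d - 2 * i)%N]|%:R =
     (if pi \in L then
        ((x - 1) * gauss_binom R q (d - 1) (2 * i - 1)
         + q%:R ^+ (2 * i - 1) * gauss_binom R q (d - 1) (2 * i))
        * q%:R ^+ ((2 * i - 1) * (i - 1))
      else
        x * gauss_binom R q (d - 1) (2 * i - 1)
        * q%:R ^+ ((2 * i - 1) * (i - 1)))).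
Proof.
move=> q x; have /andP[i1 id] := i_range.
have [A0 A0G] := class_neq0 G_class.
have d1 : (1 < d)%N by lia.
pose P : R := \prod_(1 <= k < d.-1) (q%:R ^+ k + 1).
have P0 : P != 0.
  rewrite prodf_seq_neq0; apply/allP => k _ /=.
  by rewrite -natrX natr1 pnatr_eq0.
(* [P] is the number of members of [G] through a point, so the parameter is the total weight of the
   points. *)
have xE w : #|L|%:R = (\sum_(p in points F d) w p) * P -> x = \sum_(p in points F d) w p.
  by move=> e; rewrite /x /parameter e mulfK.
have cardL : #|L|%:R = \sum_(B in G) (B \in L)%:R :> R.
  have := sum_indicator R predT L_sub_G; under eq_bigl do rewrite andbT.
  by move=> ->; congr (_%:R); apply: eq_card => B; rewrite inE andbT.
rewrite (cameron_lieblerP _ L_sub_G); split=> [[w ew] pi piG|cnt].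
  rewrite intersection_numberE ?card_field_gt1 //.
  rewrite -(sum_indicator R (fun B => \dim (pi :&: B) == (d - 2 * i)%N) L_sub_G).
  rewrite (xE w); last first.
    by rewrite cardL (eq_bigr _ ew) (sum_class_points _ G_class d1 A0G).
  rewrite (ew pi piG) -(sum_related_points G_class i_range w piG).
  by apply: eq_bigr => B /andP[BG _]; apply: ew.
have [w ew] := point_decomposition G (fun B => (B \in L)%:R : R).
exists w => B BG.
pose v A : R := (A \in L)%:R - \sum_(p in points F d | (p <= A)%VS) w p.
(* The remainder [v] sums to 0 over every point, hence over [G], so [L] and its projection have the
   same total. *)
have xw : x = \sum_(p in points F d) w p.
  apply: xE; rewrite cardL -(sum_class_points w G_class d1 A0G).
  apply/eqP; rewrite -subr_eq0 -sumrB.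
  by apply/eqP; apply: (sum_through_zero G_class (v := v) (ltnW d1) ew).
apply/eqP; rewrite -subr_eq0; apply/eqP.
apply: (eigenvector_trivial G_class i_range (v := v) d_even ew _ BG) => A AG.
(* The assumed counts and [sum_related_points] share the constant [k1 * x]; it cancels in the
   difference, leaving the eigenvalue equation for [v]. *)
rewrite /v sumrB sum_indicator // cnt // intersection_numberE ?card_field_gt1 //.
rewrite (sum_related_points G_class i_range w AG) -xw half_graph_eigenvalue1 //.
by rewrite rmorphB /= -!pmulrn /q; ring.
Qed.
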